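(* Let $\mathcal{H}$ be a finite-dimensional complex Hilbert space. There exists a quantum universal variable-length source code $\{(\mathbf{E}^{n},\mathbf{D}^{n})\}_{n\ge 1}$, where $(\mathbf{E}^n,\mathbf{D}^n)$ is a variable-length code on $\mathcal{H}^{\otimes n}$ with data set $\Omega_n$ and compressed spaces $\mathcal{H}_{\omega_n}$ ($\omega_n\in\Omega_n$), such that for every probability distribution $p$ on density operators on $\mathcal{H}$ and every real $R$, $$\lim_{n\to\infty}\frac{-1}{n}\log \mathrm{P}_{n,p}^{\mathbf{E}^n}\left\{\frac{1}{n}\left(\log|\Omega_n|+\log\dim\mathcal{H}_{\omega_n}\right)\ge R\right\}=\inf_{\mathbf{b}:\,H(\mathbf{b})\ge R}D(\mathbf{b}\|\mathbf{a}),$$ where $\mathbf{a}$ is the probability distribution consisting of the eigenvalues (with multiplicity) of the average state $\overline{\rho}_p=\sum_\rho p(\rho)\rho$, and $\mathbf{b}$ ranges over probability distributions on $\{1,\dots,\dim\mathcal{H}\}$.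
   Context: Logarithms are natural. $\mathcal{S}(\mathcal{K})$ is the set of density operators on $\mathcal{K}$. $H(\mathbf{b})=-\sum_i b_i\log b_i$ is the Shannon entropy and $D(\mathbf{b}\|\mathbf{a})=\sum_i b_i\log(b_i/a_i)\in[0,\infty]$ the relative entropy. Conventions: $-\log 0=+\infty$, and the infimum over the empty set is $+\infty$. TP-CP means trace-preserving completely positive. Bures' distance: $b(\rho,\sigma):=\sqrt{1-\mathrm{Tr}\,|\sqrt{\rho}\sqrt{\sigma}|}$. Variable-length code on a finite-dimensional Hilbert space $\mathcal{K}$: a finite data set $\Omega$; a POVM $\{M_\omega\}_{\omega\in\Omega}$ on $\mathcal{K}$; finite-dimensional Hilbert spaces $\mathcal{H}_\omega$; TP-CP maps $E_\omega$ from operators on $\mathcal{K}$ to operators on $\mathcal{H}_\omega$; the encoder is $\mathbf{E}=\{\mathbf{E}_\omega\}_{\omega\in\Omega}$ with $\mathbf{E}_\omega(\rho):=E_\omega(\sqrt{M_\omega}\,\rho\,\sqrt{M_\omega})$; the decoder is a family $\mathbf{D}=\{\mathbf{D}_\omega\}_{\omega\in\Omega}$ of TP-CP maps from operators on $\mathcal{H}_\omega$ to operators on $\mathcal{K}$. The coding length for outcome $\omega$ is $\log|\Omega|+\log\dim\mathcal{H}_\omega$. Source: $p$ is a (discrete) probability distribution on $\mathcal{S}(\mathcal{H})$; the source emits $\vec{\rho}_n=\rho_1\otimes\cdots\otimes\rho_n$ with the i.i.d. probability $p^n(\vec\rho_n)=p(\rho_1)\cdots p(\rho_n)$. For a code $(\mathbf{E}^n,\mathbf{D}^n)$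 on $\mathcal{H}^{\otimes n}$, the distribution of the outcome is $$\mathrm{P}_{n,p}^{\mathbf{E}^n}(\omega_n):=\sum_{\vec\rho_n}p^n(\vec\rho_n)\,\mathrm{Tr}\,\mathbf{E}^n_{\omega_n}(\vec\rho_n)=\mathrm{Tr}\,\mathbf{E}^n_{\omega_n}(\overline{\rho}_p^{\otimes n}),$$ and the average error is $$\epsilon_{n,p}(\mathbf{E}^n,\mathbf{D}^n):=\sum_{\vec\rho_n}p^n(\vec\rho_n)\sum_{\omega_n\in\Omega_n}\mathrm{Tr}\,\mathbf{E}^n_{\omega_n}(\vec\rho_n)\;b^2\!\left(\vec\rho_n,\mathbf{D}^n_{\omega_n}\!\left(\frac{\mathbf{E}^n_{\omega_n}(\vec\rho_n)}{\mathrm{Tr}\,\mathbf{E}^n_{\omega_n}(\vec\rho_n)}\right)\right),$$ terms with $\mathrm{Tr}\,\mathbf{E}^n_{\omega_n}(\vec\rho_n)=0$ being $0$. The sequence $\{(\mathbf{E}^n,\mathbf{D}^n)\}$ (which does not depend on $p$) is called universal if $\epsilon_{n,p}(\mathbf{E}^n,\mathbf{D}^n)\to0$ as $n\to\infty$ for every $p$. *)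

(* Defs.v *)
From mathcomp Require Import all_boot all_order all_algebra.
From mathcomp Require Import complex.
From mathcomp Require Import all_classical all_reals all_analysis.

Set Implicit Arguments.
Unset Strict Implicit.
Unset Printing Implicit Defensive.
Import Order.TTheory GRing.Theory Num.Theory.
Import numFieldNormedType.Exports.

Local Open Scope classical_set_scope.
Local Open Scope ring_scope.
Local Open Scope sesquilinear_scope.
Local Open Scope complex_scope.

(* A finite-dimensional Hilbert space of dimension d is R[i]^d with its standard
   inner product; operators on it are d x d matrices acting on column vectors. *)

Section Operators.
Variable R : realType.
Local Notation C := R[i].

(* For z : R[i], 0 <= z means that z is real and nonnegative, so psdmx A entails
   that A is Hermitian. *)
Definition psdmx d (A : 'M[C]_d) : Prop :=
  forall v : 'cV[C]_d, 0 <= (v ^t* *m A *m v) ord0 ord0.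

Definition density d : set 'M[C]_d := [set rho | psdmx rho /\ \tr rho = 1].

(* Functional calculus on A = P^-1 diag(x) P with P unitary; this is the positive
   square root of A when A is positive semidefinite, and is only used then. *)
Definition sqrtmx d (A : 'M[C]_d) : 'M[C]_d :=
  invmx (spectralmx A) *m diag_mx (map_mx sqrtC (spectral_diag A))
    *m spectralmx A.

Definition absmx d (A : 'M[C]_d) : 'M[C]_d := sqrtmx (A ^t* *m A).

Definition bures d (rho sigma : 'M[C]_d) : R :=
  Num.sqrt (1 - complex.Re (\tr (absmx (sqrtmx rho *m sqrtmx sigma)))).

(* (id_k (x) Phi)(X), where X is a k x k block matrix with blocks in 'M_m. *)
Definition ampliation m n (Phi : 'M[C]_m -> 'M[C]_n) (k : nat)
    (X : 'M[C]_(\sum_(i < k) m)) : 'M[C]_(\sum_(i < k) n) :=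
  \mxblock_(i < k, j < k) Phi (submxblock X i j).

Definition completely_positive m n (Phi : 'M[C]_m -> 'M[C]_n) : Prop :=
  forall k (X : 'M[C]_(\sum_(i < k) m)), psdmx X -> psdmx (ampliation Phi X).

Definition tpcp m n (Phi : {linear 'M[C]_m -> 'M[C]_n}) : Prop :=
  (forall A, \tr (Phi A) = \tr A) /\ completely_positive Phi.

(* The n-fold tensor power of R[i]^d has the product basis
   e_(f 0) (x) ... (x) e_(f (n-1)) indexed by f : {ffun 'I_n -> 'I_d}, enumerated
   by enum_val; its dimension is d ^ n. *)
Definition tdim (d n : nat) : nat := #|{: {ffun 'I_n -> 'I_d}}|.

Definition tensor d n (rho : {ffun 'I_n -> 'M[C]_d}) : 'M[C]_(tdim d n) :=
  \matrix_(i, j) \prod_(k < n)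
    rho k ((enum_val i : {ffun 'I_n -> 'I_d}) k)
          ((enum_val j : {ffun 'I_n -> 'I_d}) k).

End Operators.

Section Codes.
Variable R : realType.
Local Notation C := R[i].

(* Variable-length codes on R[i]^K, with compressed spaces R[i]^(cdim w). *)
Record vlcode (K : nat) := Vlcode {
  outcome : finType;
  povm : outcome -> 'M[C]_K;
  povm_psd : forall w, psdmx (povm w);
  povm_sum : \sum_w povm w = 1%:M;
  cdim : outcome -> nat;
  encmap : forall w, {linear 'M[C]_K -> 'M[C]_(cdim w)};
  encmap_tpcp : forall w, tpcp (encmap w);
  decoder : forall w, {linear 'M[C]_(cdim w) -> 'M[C]_K};
  decoder_tpcp : forall w, tpcp (decoder w)
}.

Definition encoder K (c : vlcode K) (w : outcome c) (rho : 'M[C]_K) :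
    'M[C]_(cdim w) :=
  encmap w (sqrtmx (povm w) *m rho *m sqrtmx (povm w)).

Definition codelength K (c : vlcode K) (w : outcome c) : R :=
  ln #|outcome c|%:R + ln (cdim w)%:R.

End Codes.

Section Source.
Variables (R : realType) (d : nat).
Local Notation C := R[i].

(* Discrete probability distributions on density operators: the unordered sum
   being 1, the support is countable. Only the values of p on density matter. *)
Definition source (p : 'M[C]_d -> R) : Prop :=
  (forall rho, density rho -> 0 <= p rho) /\
  (\esum_(rho in @density R d) (p rho)%:E = 1)%E.

(* Unordered sum of a summable real family. *)
Definition rsum (T : choiceType) (D : set T) (f : T -> R) : R :=
  fine (\esum_(x in D) (EFin \o f)^\+ x - \esum_(x in D) (EFin \o f)^\- x)%E.

Definition avgstate (p : 'M[C]_d -> R) : 'M[C]_d :=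
  \matrix_(i, j)
    (rsum (@density R d) (fun rho => p rho * complex.Re (rho i j)) +i*
     rsum (@density R d) (fun rho => p rho * complex.Im (rho i j))).

Definition words n : set {ffun 'I_n -> 'M[C]_d} :=
  [set rho | forall k, density (rho k)].

Definition wordprob n (p : 'M[C]_d -> R) (rho : {ffun 'I_n -> 'M[C]_d}) : R :=
  \prod_(k < n) p (rho k).

Definition outprob n (p : 'M[C]_d -> R) (c : vlcode R (tdim d n))
    (w : outcome c) : \bar R :=
  (\esum_(rho in @words n)
    (wordprob p rho * complex.Re (\tr (encoder w (tensor rho))))%:E)%E.

Definition outprob_ge n (p : 'M[C]_d -> R) (c : vlcode R (tdim d n)) (r : R) :
    \bar R :=
  (\sum_(w : outcome c | (r <= n%:R^-1 * codelength w)%R) outprob p w)%E.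

Definition worderror n (c : vlcode R (tdim d n))
    (rho : {ffun 'I_n -> 'M[C]_d}) : R :=
  \sum_(w : outcome c)
    (let s := encoder w (tensor rho) in
     complex.Re (\tr s) *
     bures (tensor rho) (decoder w ((\tr s)^-1 *: s)) ^+ 2).

Definition avgerror n (p : 'M[C]_d -> R) (c : vlcode R (tdim d n)) : \bar R :=
  (\esum_(rho in @words n) (wordprob p rho * worderror c rho)%:E)%E.

(* The length 0 code plays no role in this notion. *)
Definition universal (c : forall n, vlcode R (tdim d n)) : Prop :=
  forall p : 'M[C]_d -> R, source p ->
    (fun n => avgerror p (c n)) @ \oo --> 0%E.

End Source.

Section Entropy.
Variables (R : realType) (d : nat).

Definition distr (b : 'I_d -> R) : Prop :=
  (forall i, 0 <= b i) /\ \sum_i b i = 1.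

(* ln 0 = 0 in the library, in agreement with 0 log 0 = 0. *)
Definition entropy (b : 'I_d -> R) : R := - \sum_i b i * ln (b i).

Definition relentropy (b a : 'I_d -> R) : \bar R :=
  (\sum_i (if b i == 0%R then 0
           else if a i == 0%R then +oo
           else (b i * ln (b i / a i))%:E))%E.

(* For Hermitian A, the eigenvalues of A with multiplicity. *)
Definition eigenvalues (A : 'M[R[i]]_d) (i : 'I_d) : R :=
  complex.Re (spectral_diag A ord0 i).

End Entropy.

(* Main.v *)
(* The words of length n have polynomially many types (empirical distributions), and
   at most poly(n) e^(nt) words have a type of entropy at most t. All tensor powers
   A^(x)n lie in a space of matrices of polynomial dimension, as their entries are
   monomials determined by the joint type of the indices. Let V_t be the span of the
   B e_x, for B in this space and x a word whose type has entropy at most t: then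
   dim V_t <= poly(n) e^(nt), yet V_t contains the low entropy words of every
   eigenbasis. With Q_t the projector on V_t, the code measures the increments
   Q_t - Q_(t - m eta), each with weight 1/m, where t runs over a grid of step eta; it
   then compresses into V_t. The data set is padded with e^(n eta) outcomes of
   probability 0, which only lengthen the code.
   - Error: the window ]t - m eta, t] misses the entropy of the average state only for
     a vanishing fraction of the weight, and for the other t the measurement is
     gentle: the fidelity of rho and E rho E / tr(E rho) is exactly sqrt(tr(E rho)).
   - Exponent, lower bound: tr(rho^(x)n (1 - Q_t)) is at most the probability that the
     type has entropy > t, to which the method of types applies.
   - Exponent, upper bound: the POVM elements of rate < r have total trace at most
     e^(nr - n eta), too small to carry the b-typical words if H(b) >= r; a change of
     measure from b to the spectrum of rho costs e^(-n D(b||a)). *)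
From HB Require Import structures.
Require Import Defs.
From mathcomp Require Import all_boot all_order all_algebra.
From mathcomp Require Import complex.
From mathcomp Require Import all_classical all_reals all_analysis.
From mathcomp Require Import ring lra zify.

Set Implicit Arguments.
Unset Strict Implicit.
Unset Printing Implicit Defensive.
Import Order.TTheory GRing.Theory Num.Theory.
Import numFieldNormedType.Exports.

Local Open Scope classical_set_scope.
Local Open Scope ring_scope.
Local Open Scope sesquilinear_scope.
Local Open Scope complex_scope.

(** * Adjoints, and matrices whose quadratic form is real *)

Section Adjoint.
Variable C : numClosedFieldType.

Lemma mulmx_adj m n p (A : 'M[C]_(m, n)) (B : 'M[C]_(n, p)) :
  (A *m B)^t* = B^t* *m A^t*.
Proof. by rewrite trmx_mul map_mxM. Qed.

Lemma adjD m n (A B : 'M[C]_(m, n)) : (A + B)^t* = A^t* + B^t*.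
Proof. by rewrite linearD map_mxD. Qed.

Lemma adjB m n (A B : 'M[C]_(m, n)) : (A - B)^t* = A^t* - B^t*.
Proof. by rewrite linearB map_mxB. Qed.

Lemma adjZ m n (c : C) (A : 'M[C]_(m, n)) : (c *: A)^t* = c^*%R *: A^t*.
Proof. by rewrite linearZ map_mxZ. Qed.

Lemma adj1 n : (1%:M : 'M[C]_n)^t* = 1%:M.
Proof. by rewrite trmx1 map_mx1. Qed.

Lemma mx_sesqE n (A : 'M[C]_n) i j :
  A i j = ((delta_mx i ord0 : 'cV_n)^t* *m A *m (delta_mx j ord0 : 'cV_n)) ord0 ord0.
Proof.
rewrite -mulmxA -colE mxE (bigD1 i)//= big1 ?addr0.
  by rewrite !mxE !eqxx/= conjC1 mul1r.
by move=> k ki; rewrite !mxE (negbTE ki)/= conjC0 mul0r.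
Qed.

(** Polarization: the form is real at e_i + e_j and at e_i + 'i e_j, and expanding both gives two
    linear relations between [A i j], [A j i] and their conjugates, whose sum is the claim. *)
Lemma real_form_herm n (A : 'M[C]_n) :
  (forall v : 'cV[C]_n, (v^t* *m A *m v) ord0 ord0 \is Num.real) -> A^t* = A.
Proof.
move=> hA.
have real (v : 'cV[C]_n) : ((v^t* *m A *m v) ord0 ord0)^*%R = (v^t* *m A *m v) ord0 ord0.
  exact/conj_Creal/hA.
pose q (u v : 'cV[C]_n) : C := (u^t* *m A *m v) ord0 ord0.
have qDl u v w : q (u + v) w = q u w + q v w.
  by rewrite /q adjD !mulmxDl mxE.
have qDr u v w : q u (v + w) = q u v + q u w.
  by rewrite /q mulmxDr mxE.
have qZl c u v : q (c *: u) v = c^*%R * q u v.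
  by rewrite /q adjZ -!scalemxAl mxE.
have qZr c u v : q u (c *: v) = c * q u v.
  by rewrite /q -!scalemxAr mxE.
apply/matrixP => i j; rewrite !mxE.
pose u : 'cV[C]_n := delta_mx i ord0; pose v : 'cV[C]_n := delta_mx j ord0.
have -> : A i j = q u v by rewrite mx_sesqE.
have -> : A j i = q v u by rewrite mx_sesqE.
have := real (u + v); rewrite -/(q _ _) !qDl !qDr !rmorphD /=.
have := real (u + 'i *: v); rewrite -/(q _ _) !qDl !qDr !qZl !qZr conjCi !rmorphD /=.
rewrite !rmorphM !rmorphN /= !conjCi.
have -> : (q u u)^*%R = q u u by exact: real.
have -> : (q v v)^*%R = q v v by exact: real.
set a := q u v; set b := q v u; set x := q u u; set y := q v v => h1 h2.
have i2 : 'i * 'i = -1 :> C by rewrite -expr2 sqrCi.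
have e1 : a^*%R + b^*%R - (a + b) = 0.
  by rewrite -(subrr (x + a + (b + y))) -{1}h2; ring.
have e2 : b^*%R - a^*%R - (a - b) = 0.
  apply: (mulfI (neq0Ci C)); rewrite mulr0.
  by rewrite -(subrr (x + 'i * a + (- 'i * b + - 'i * ('i * y)))) -{1}h1; ring: i2.
suff : 2 * b^*%R = 2 * a by apply: mulfI; rewrite pnatr_eq0.
apply/eqP; rewrite -subr_eq0; apply/eqP.
by rewrite -(addr0 0) -{1}e1 -e2; ring.
Qed.

End Adjoint.

(** * Positive semidefinite matrices, square roots and projectors *)

Section Positive.
Variable C : numClosedFieldType.

(* psdmx and sqrtmx over an abstract field, where conversion cannot unfold the
   arithmetic of R[i]. *)
Definition psd n (A : 'M[C]_n) : Prop :=
  forall v : 'cV[C]_n, 0 <= (v^t* *m A *m v) ord0 ord0.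

Definition psdsqrt n (A : 'M[C]_n) : 'M[C]_n :=
  invmx (spectralmx A) *m diag_mx (map_mx sqrtC (spectral_diag A))
    *m spectralmx A.

Lemma psdD n (A B : 'M[C]_n) : psd A -> psd B -> psd (A + B).
Proof. by move=> hA hB v; rewrite mulmxDr mulmxDl mxE addr_ge0. Qed.

Lemma psdZ n (c : C) (A : 'M[C]_n) : 0 <= c -> psd A -> psd (c *: A).
Proof. by move=> hc hA v; rewrite -scalemxAr -scalemxAl mxE mulr_ge0. Qed.

Lemma psd0 n : psd (0 : 'M[C]_n).
Proof. by move=> v; rewrite mulmx0 mul0mx mxE. Qed.

Lemma psd_sum n (I : Type) (r : seq I) (P : pred I) (F : I -> 'M[C]_n) :
  (forall i, P i -> psd (F i)) -> psd (\sum_(i <- r | P i) F i).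
Proof.
move=> h; elim: r => [|i r IH]; first by rewrite big_nil; exact: psd0.
rewrite big_cons; case: ifP => [Pi|_]; last exact: IH.
exact: psdD (h _ Pi) IH.
Qed.

Lemma psd_congr m n (A : 'M[C]_n) (B : 'M[C]_(n, m)) :
  psd A -> psd (B^t* *m A *m B).
Proof.
by move=> hA v; have := hA (B *m v); rewrite mulmx_adj !mulmxA.
Qed.

Lemma psd_gram m n (B : 'M[C]_(n, m)) : psd (B^t* *m B).
Proof.
move=> v; rewrite !mulmxA -mulmx_adj -mulmxA mxE sumr_ge0// => i _.
by rewrite !mxE mulrC mul_conjC_ge0.
Qed.

Lemma psd_diag_ge0 n (A : 'M[C]_n) i : psd A -> 0 <= A i i.
Proof.
move=> /(_ (delta_mx i ord0)).
rewrite -mulmxA -colE mxE (bigD1 i)//= big1 ?addr0.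
  by rewrite !mxE !eqxx/= conjC1 mul1r.
by move=> j ji; rewrite !mxE (negbTE ji)/= conjC0 mul0r.
Qed.

Lemma psd_tr_ge0 n (A : 'M[C]_n) : psd A -> 0 <= \tr A.
Proof. by move=> h; rewrite sumr_ge0// => i _; exact: psd_diag_ge0. Qed.

Lemma psd_herm n (A : 'M[C]_n) : psd A -> A^t* = A.
Proof. by move=> hA; apply: real_form_herm => v; exact/ger0_real/hA. Qed.

Lemma psd_spectral n (A : 'M[C]_n) : psd A ->
  A = (spectralmx A)^t* *m diag_mx (spectral_diag A) *m spectralmx A.
Proof.
move=> hA; have /orthomx_spectralP {1}-> : A \is normalmx.
  by apply/normalmxP; rewrite psd_herm.
by rewrite invmx_unitary// spectral_unitarymx.
Qed.

Lemma unitary_mulmxV n (U : 'M[C]_n) : U \is unitarymx -> U *m U^t* = 1%:M.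
Proof. by move/unitarymxP. Qed.

Lemma unitary_mulVmx n (U : 'M[C]_n) : U \is unitarymx -> U^t* *m U = 1%:M.
Proof. by move=> /unitarymxP h; exact: mulmx1C. Qed.

Lemma spectral_diagE n (A : 'M[C]_n) : psd A ->
  diag_mx (spectral_diag A) = spectralmx A *m A *m (spectralmx A)^t*.
Proof.
move=> hA; rewrite {3}(psd_spectral hA).
rewrite !mulmxA (unitary_mulmxV (spectral_unitarymx A)) mul1mx -mulmxA.
by rewrite (unitary_mulmxV (spectral_unitarymx A)) mulmx1.
Qed.

Lemma spectral_diag_ge0 n (A : 'M[C]_n) i : psd A ->
  0 <= spectral_diag A ord0 i.
Proof.
move=> hA; have := spectral_diagE hA.
rewrite -{1}(trmxCK (spectralmx A)) => /matrixP /(_ i i).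
by rewrite mxE eqxx mulr1n => ->; apply/psd_diag_ge0/psd_congr.
Qed.

Lemma psd_diag n (s : 'rV[C]_n) : (forall i, 0 <= s ord0 i) -> psd (diag_mx s).
Proof.
move=> hs v; rewrite -mulmxA mxE sumr_ge0// => i _.
by rewrite mul_diag_mx !mxE mulrCA mulr_ge0// mulrC mul_conjC_ge0.
Qed.

Lemma psdsqrtE n (A : 'M[C]_n) : psdsqrt A =
  (spectralmx A)^t* *m diag_mx (map_mx sqrtC (spectral_diag A)) *m spectralmx A.
Proof. by rewrite /psdsqrt invmx_unitary// spectral_unitarymx. Qed.

Lemma psdsqrt_psd n (A : 'M[C]_n) : psd A -> psd (psdsqrt A).
Proof.
move=> hA; rewrite psdsqrtE; apply: psd_congr; apply: psd_diag => i.
by rewrite mxE sqrtC_ge0 spectral_diag_ge0.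
Qed.

Lemma psdsqrt_sqr n (A : 'M[C]_n) : psd A -> psdsqrt A *m psdsqrt A = A.
Proof.
move=> hA; rewrite [RHS](psd_spectral hA) psdsqrtE.
have hU := unitary_mulmxV (spectral_unitarymx A).
rewrite !mulmxA -(mulmxA _ (spectralmx A)) hU mulmx1.
rewrite -(mulmxA _ (diag_mx _) (diag_mx _)) mulmx_diag.
suff -> : (\row_j (map_mx sqrtC (spectral_diag A) ord0 j *
  map_mx sqrtC (spectral_diag A) ord0 j)) = spectral_diag A by [].
by apply/rowP => i; rewrite !mxE -expr2 sqrtCK.
Qed.

(** By cyclicity this is the trace of B^(1/2) A B^(1/2), a congruence of A. *)
Lemma psd_trM_ge0 n (A B : 'M[C]_n) : psd A -> psd B -> 0 <= \tr (A *m B).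
Proof.
move=> hA hB; rewrite -(psdsqrt_sqr hB) mulmxA mxtrace_mulC mulmxA.
apply: psd_tr_ge0; rewrite -{1}(psd_herm (psdsqrt_psd hB)).
exact: psd_congr.
Qed.

Definition is_proj n (P : 'M[C]_n) := P^t* = P /\ P *m P = P.

Lemma proj_psd n (P : 'M[C]_n) : is_proj P -> psd P.
Proof. by case=> h1 <-; rewrite -{1}h1; exact: psd_gram. Qed.

Lemma projC n (P : 'M[C]_n) : is_proj P -> is_proj (1%:M - P).
Proof.
move=> [h1 h2]; split; first by rewrite adjB adj1 h1.
by rewrite mulmxBr mulmx1 mulmxBl mul1mx h2 subrr subr0.
Qed.

(** The eigenvalues y of c P satisfy y^2 = c y, and on 0 and c the square root agrees with the
    linear map y |-> (sqrt c / c) y. The functional calculus thus reduces to a scaling, without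
    appeal to the uniqueness of positive square roots. *)
Lemma psdsqrt_proj n (c : C) (P : 'M[C]_n) : 0 <= c -> is_proj P ->
  psdsqrt (c *: P) = sqrtC c *: P.
Proof.
move=> hc hP; have [h1 h2] := hP; set A := c *: P.
have hA : psd A by apply: psdZ => //; exact: proj_psd.
have eAA : A *m A = c *: A by rewrite /A -scalemxAl -scalemxAr h2.
have dd i : spectral_diag A ord0 i ^+ 2 = c * spectral_diag A ord0 i.
  have : diag_mx (spectral_diag A) *m diag_mx (spectral_diag A) =
         c *: diag_mx (spectral_diag A).
    rewrite spectral_diagE// !mulmxA -(mulmxA _ _ (spectralmx A)).
    rewrite (unitary_mulVmx (spectral_unitarymx A)) mulmx1.
    by rewrite -(mulmxA _ A A) eAA -scalemxAr -scalemxAl.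
  rewrite mulmx_diag => /matrixP /(_ i i).
  by rewrite !mxE eqxx !mulr1n expr2.
(* For c = 0 the quotient is 0 by convention, the right value since then A = 0. *)
have -> : psdsqrt A = (sqrtC c / c) *: A.
  rewrite [X in _ *: X](psd_spectral hA) psdsqrtE scalemxAl scalemxAr.
  suff -> : diag_mx (map_mx sqrtC (spectral_diag A)) =
            (sqrtC c / c) *: diag_mx (spectral_diag A) by [].
  apply/matrixP => i j; rewrite !mxE; case: eqP => [->|_]; last by rewrite mulr0n mulr0.
  rewrite !mulr1n; have /eqP := dd j; set y := spectral_diag A ord0 j.
  rewrite expr2 -subr_eq0 -mulrBl mulf_eq0 subr_eq0 => /orP[/eqP ->|/eqP ->].
    have [->|c0] := eqVneq c 0; first by rewrite mulr0 sqrtC0.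
    by rewrite divfK.
  by rewrite sqrtC0 mulr0.
rewrite /A scalerA; have [->|c0] := eqVneq c 0; first by rewrite sqrtC0 !mul0r.
by rewrite divfK.
Qed.

End Positive.

(** * Characteristic polynomials of AB and BA *)

Section CharPolyMul.
Variable F : fieldType.

(** The block determinant of [X, a; b, 1] is evaluated by two block eliminations. The second one
    introduces a factor X^n on both sides, which cancels. *)
Lemma char_poly_mulC n (A B : 'M[F]_n) : char_poly (A *m B) = char_poly (B *m A).
Proof.
rewrite /char_poly /char_poly_mx !map_mxM/=.
set a := map_mx _ A; set b := map_mx _ B.
pose M := block_mx 'X%:M a b 1%:M.
have e1 : \det M = \det ('X%:M - a *m b).
  have : M *m block_mx 1%:M 0 (- b) 1%:M = block_mx ('X%:M - a *m b) a 0 1%:M.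
    by rewrite mulmx_block !mulmx1 !mulmx0 !mul1mx add0r mulmxN subrr add0r.
  move/(congr1 determinant); rewrite det_mulmx det_lblock det_ublock !det1.
  by rewrite !mulr1.
have e2 : \det M * 'X ^+ n = 'X ^+ n * \det ('X%:M - b *m a).
  have : M *m block_mx 1%:M (- a) 0 'X%:M = block_mx 'X%:M 0 b ('X%:M - b *m a).
    rewrite mulmx_block !mulmx1 !mulmx0 !mul1mx !addr0 !mulmxN.
    by rewrite mul_scalar_mx mul_mx_scalar addNr addrC.
  move/(congr1 determinant); rewrite det_mulmx det_lblock det_ublock !det1 !mul1r.
  by rewrite !det_scalar.
apply: (mulfI (expf_neq0 n (negbT (polyX_eq0 F)))).
by rewrite -e2 e1 mulrC.
Qed.

End CharPolyMul.

(** * Fidelity of a state and its projection *)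

Section Fidelity.
Variable C : numClosedFieldType.

Lemma char_poly_unitary_diag n (U : 'M[C]_n) (s : 'rV[C]_n) :
  U \is unitarymx ->
  char_poly (U^t* *m diag_mx s *m U) = \prod_(x <- [seq s ord0 i | i : 'I_n]) ('X - x%:P).
Proof.
move=> hU; rewrite char_poly_mulC mulmxA unitary_mulmxV// mul1mx.
rewrite char_poly_trig ?diag_mx_is_trig// big_map/= big_enum/=.
by apply: eq_bigr => i _; rewrite mxE eqxx mulr1n.
Qed.

(* |B| and |B^*| have the same eigenvalues, so the trace norm of B can be read off
   a positive square root of B B^*. *)
Lemma tr_absmx n (B S : 'M[C]_n) : psd S -> B *m B^t* = S *m S ->
  \tr (psdsqrt (B^t* *m B)) = \tr S.
Proof.
move=> hS hB; set A := B^t* *m B.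
have hA : psd A by exact: psd_gram.
have perm : perm_eq [seq spectral_diag A ord0 i | i : 'I_n]
                    [seq (spectral_diag S ord0 i) ^+ 2 | i : 'I_n].
  apply: prod_XsubC_eq; rewrite -(char_poly_unitary_diag _ (spectral_unitarymx A)).
  rewrite -(psd_spectral hA) /A char_poly_mulC hB.
  have -> : S *m S = (spectralmx S)^t* *m
      diag_mx (\row_i (spectral_diag S ord0 i) ^+ 2) *m spectralmx S.
    rewrite {1 2}(psd_spectral hS) !mulmxA -(mulmxA _ (spectralmx S)).
    rewrite (unitary_mulmxV (spectral_unitarymx S)) mulmx1.
    by rewrite -(mulmxA _ (diag_mx _) (diag_mx _)) mulmx_diag.
  rewrite char_poly_unitary_diag ?spectral_unitarymx//.
  by congr (\prod_(x <- _) _); apply: eq_map => i; rewrite mxE.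
have trU (s : 'rV[C]_n) (U : 'M[C]_n) : U \is unitarymx ->
    \tr (U^t* *m diag_mx s *m U) = \sum_i s ord0 i.
  by move=> hU; rewrite mxtrace_mulC mulmxA unitary_mulmxV// mul1mx mxtrace_diag.
rewrite psdsqrtE trU ?spectral_unitarymx// [in RHS](psd_spectral hS).
rewrite trU ?spectral_unitarymx//.
transitivity (\sum_(x <- [seq spectral_diag A ord0 i | i : 'I_n]) sqrtC x).
  by rewrite big_map/= big_enum/=; apply: eq_bigr => i _; rewrite mxE.
rewrite (perm_big _ perm) big_map/= big_enum/=; apply: eq_bigr => i _.
by rewrite sqrCK// spectral_diag_ge0.
Qed.

Lemma psd_compress n (A E : 'M[C]_n) : psd A -> is_proj E -> psd (E *m A *m E).
Proof. by move=> hA [hE _]; have := psd_congr E hA; rewrite hE. Qed.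

Lemma tr_proj_bounds n (rho E : 'M[C]_n) : psd rho -> is_proj E -> \tr rho = 1 ->
  0 <= \tr (E *m rho) <= 1.
Proof.
move=> hrho hE trho; apply/andP; split; first exact: psd_trM_ge0 (proj_psd hE) hrho.
rewrite -trho -subr_ge0.
have -> : \tr rho - \tr (E *m rho) = \tr ((1%:M - E) *m rho).
  by rewrite mulmxBl mul1mx raddfB.
exact: psd_trM_ge0 (proj_psd (projC hE)) hrho.
Qed.

(** With r = sqrt rho, t = tr(E rho) and u = sqrt t, the product of B and its adjoint is r sg r =
    t^-1 (r E r)^2. Its positive square root is u^-1 r E r, of trace t / u = u. *)
Lemma fidelity_proj n (rho E : 'M[C]_n) : psd rho -> is_proj E ->
  \tr (E *m rho) != 0 ->
  let sg := (\tr (E *m rho))^-1 *: (E *m rho *m E) in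
  let B := psdsqrt rho *m psdsqrt sg in
  \tr (psdsqrt (B^t* *m B)) = sqrtC (\tr (E *m rho)).
Proof.
move=> hrho hE t0 sg B; set t := \tr _ in t0 sg B *.
have [hE1 hE2] := hE.
have ht : 0 <= t by exact: psd_trM_ge0 (proj_psd hE) hrho.
set u := sqrtC t.
have tu : t = u ^+ 2 by rewrite /u sqrtCK.
have u0 : 0 <= u by rewrite sqrtC_ge0.
have un0 : u != 0 by rewrite /u sqrtC_eq0.
set r := psdsqrt rho.
have hr : psd r by exact: psdsqrt_psd.
have hrr : r *m r = rho by exact: psdsqrt_sqr.
have hra : r^t* = r by exact: psd_herm.
have hsg : psd sg by apply: psdZ; rewrite ?invr_ge0//; exact: psd_compress.
have hs := psdsqrt_psd hsg.
rewrite (@tr_absmx _ B (u^-1 *: (r *m E *m r))).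
- rewrite mxtraceZ mxtrace_mulC mulmxA hrr mxtrace_mulC -/t tu expr2 mulrA.
  by rewrite mulVf// mul1r.
- by apply: psdZ; rewrite ?invr_ge0// -{1}hra; apply/psd_congr/proj_psd.
rewrite /B -/r mulmx_adj (psd_herm hs) hra mulmxA -(mulmxA r _ (psdsqrt sg)).
rewrite psdsqrt_sqr// /sg tu -!scalemxAr -!scalemxAl scalerA -invfM -expr2.
clearbody r; rewrite !mulmxA.
by rewrite -(mulmxA (r *m E) r r) hrr.
Qed.

End Fidelity.

(** * Bures distance after a projective measurement *)

Section Bures.
Variable R : realType.
Local Notation C := R[i].

Lemma Re_le (x y : C) : x <= y -> complex.Re x <= complex.Re y.
Proof. by rewrite lecE => /andP[]. Qed.

(** The squared distance is 1 - sqrt t with t = tr(E rho), and t <= sqrt t on [0, 1]. The bound sqrt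
    t <= 1 also keeps the real square root in [bures] away from its default value on negative
    numbers. *)
Lemma bures_proj n (rho E : 'M[C]_n) : psdmx rho -> is_proj E ->
  \tr rho = 1 -> \tr (E *m rho) != 0 ->
  bures rho ((\tr (E *m rho))^-1 *: (E *m rho *m E)) ^+ 2
    <= 1 - complex.Re (\tr (E *m rho)).
Proof.
move=> hrho hE trho t0.
have /andP[t_ge0 t_le1] := tr_proj_bounds hrho hE trho.
have /= hF := fidelity_proj hrho hE t0.
rewrite /bures /absmx [\tr (sqrtmx _)]hF.
move: t_ge0 t_le1; set t := \tr _ => t_ge0 t_le1; clearbody t.
have u1 : sqrtC t <= 1 by rewrite -sqrtC1 ler_sqrtC// qualifE/= ler01.
have tu : t <= sqrtC t.
  by rewrite -{1}(sqrtCK t) expr2 ler_piMl// sqrtC_ge0.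
move/Re_le: u1 => /= u1; move/Re_le: tu => tu.
rewrite sqr_sqrtr; last by rewrite subr_ge0.
by rewrite lerD2l lerN2.
Qed.

End Bures.

(** * Kraus maps are trace-preserving and completely positive *)

Section Kraus.
Variable C : numClosedFieldType.

Definition kraus (I : finType) m n (K : I -> 'M[C]_(n, m)) (X : 'M[C]_m) :
  'M[C]_n := \sum_l K l *m X *m (K l)^t*.

Lemma kraus_linear (I : finType) m n (K : I -> 'M[C]_(n, m)) : linear (kraus K).
Proof.
move=> a X Y; rewrite /kraus scaler_sumr -big_split/=; apply: eq_bigr => l _.
by rewrite mulmxDr mulmxDl -scalemxAr -scalemxAl.
Qed.

HB.instance Definition _ (I : finType) m n (K : I -> 'M[C]_(n, m)) :=
  GRing.isLinear.Build _ _ _ _ (kraus K) (@kraus_linear I m n K).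

Lemma map_mxblock_adj p q (p_ : 'I_p -> nat) (q_ : 'I_q -> nat)
    (B : forall i j, 'M[C]_(p_ i, q_ j)) :
  map_mx Num.conj (\mxblock_(i, j) B i j) = \mxblock_(i, j) map_mx Num.conj (B i j).
Proof. by apply/matrixP => i j; rewrite !mxE. Qed.

Lemma kraus_tr (I : finType) m n (K : I -> 'M[C]_(n, m)) A :
  \sum_l (K l)^t* *m K l = 1%:M -> \tr (kraus K A) = \tr A.
Proof.
move=> hK; rewrite /kraus raddf_sum/= -[in RHS](mul1mx A) -hK mulmx_suml raddf_sum.
by apply: eq_bigr => l _; rewrite /= [LHS]mxtrace_mulC mulmxA.
Qed.

(** The ampliation is itself a Kraus map, with the block-diagonal operators [G l] = 1 (x) [K l], so
    each of its terms is a congruence of X. *)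
Lemma kraus_cp (I : finType) m n (K : I -> 'M[C]_(n, m)) k
    (X : 'M[C]_(\sum_(i < k) m)) : psd X ->
  psd (\mxblock_(i < k, j < k) kraus K (submxblock X i j)).
Proof.
move=> hX.
pose G l : 'M[C]_(\sum_(i < k) n, \sum_(i < k) m) :=
  \mxblock_(i, j) (if i == j then K l else 0).
have -> : \mxblock_(i < k, j < k) kraus K (submxblock X i j) =
    \sum_l (G l)^t*^t* *m X *m (G l)^t*.
  rewrite /kraus mxblock_sum; apply: eq_bigr => l _.
  rewrite trmxCK -{2}(submxblockK X) /G tr_mxblock map_mxblock_adj !mul_mxblock.
  apply/eq_mxblock => i j.
  rewrite (bigD1 j)//= [X in _ = _ + X]big1 ?addr0; last first.
    by move=> a /negPf aj; rewrite eq_sym aj trmx0 map_mx0 mulmx0.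
  rewrite eqxx (bigD1 i)//= big1 ?addr0 ?eqxx// => a /negPf ai.
  by rewrite eq_sym ai mul0mx.
by apply: psd_sum => l _; apply: psd_congr.
Qed.

End Kraus.

Lemma kraus_tpcp (R : realType) (I : finType) m n (K : I -> 'M[R[i]]_(n, m)) :
  \sum_l (K l)^t* *m K l = 1%:M -> tpcp (kraus K).
Proof.
move=> hK; split=> [A|k X hX]; first exact: kraus_tr hK.
exact: kraus_cp hX.
Qed.

(** * Shannon entropy and the Gibbs inequality *)

Section Entropy.
Variables (R : realType) (d : nat).
Implicit Types a b : 'I_d -> R.

Lemma distr_le1 b i : distr b -> b i <= 1.
Proof.
move=> [b0 <-]; rewrite (bigD1 i)//= lerDl; apply: sumr_ge0 => j _; exact: b0.
Qed.

Lemma entropy_ge0 b : distr b -> 0 <= entropy b.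
Proof.
move=> hb; rewrite /entropy -sumrN; apply: sumr_ge0 => i _.
rewrite -mulrN mulr_ge0//; first by case: hb.
by rewrite oppr_ge0 ln_le0// distr_le1.
Qed.

(** Termwise from ln x <= x - 1 at x = a i / b i; the terms with b i = 0 only add a i >= 0. *)
Lemma gibbs a b : distr b -> (forall i, 0 <= a i) -> \sum_i a i <= 1 ->
  (forall i, b i != 0 -> a i != 0) ->
  \sum_i b i * ln (a i) <= \sum_i b i * ln (b i).
Proof.
move=> [b0 b1] a0 a1 ba.
rewrite -subr_le0 -sumrB (@le_trans _ _ (\sum_i (a i - b i)))//; last first.
  by rewrite sumrB b1 subr_le0.
apply: ler_sum => i _; have [->|bi] := eqVneq (b i) 0.
  by rewrite !mul0r subrr subr0.
have bi0 : 0 < b i by rewrite lt_def bi b0.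
have ai0 : 0 < a i by rewrite lt_def ba// a0.
rewrite -mulrBr -ln_div//.
have h : ln (a i / b i) <= a i / b i - 1.
  have := @le_ln1Dx R (a i / b i - 1); rewrite addrCA subrr addr0; apply.
  by rewrite ltrBrDr addNr divr_gt0.
apply: le_trans (ler_wpM2l (b0 i) h) _.
by rewrite mulrBr mulr1 mulrCA divff// mulr1.
Qed.

(** The Gibbs inequality against the uniform distribution. *)
Lemma entropy_le_ln b : distr b -> entropy b <= ln d%:R.
Proof.
move=> hb; have [b0 b1] := hb.
have d0 : (0 < d)%N.
  case: (posnP d) => // d0; have := b1; rewrite big1 => [/esym/eqP|i _].
    by rewrite oner_eq0.
  by have := leq_ltn_trans (leq0n i) (ltn_ord i); rewrite d0.
have := @gibbs (fun=> d%:R^-1) b hb.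
rewrite lnV ?posrE ?ltr0n// -mulr_suml b1 mul1r /entropy lerNl; apply => //.
- by rewrite sumr_const card_ord -[leLHS]mulr_natl divff// pnatr_eq0 -lt0n.
- by move=> i _; rewrite invr_neq0// pnatr_eq0 -lt0n.
Qed.

End Entropy.

(** * Method of types and i.i.d. words *)

Section Types.
Variables (R : realType) (d n : nat).
Local Notation W := {ffun 'I_n -> 'I_d}.
Implicit Types (a b : 'I_d -> R) (x : W).

Definition pword b x : R := \prod_k b (x k).
Definition etype x (i : 'I_d) : R := #|[pred k | x k == i]|%:R / n%:R.
Definition tentropy x : R := entropy (etype x).

Lemma sum_word_etype (g : 'I_d -> R) x : (0 < n)%N ->
  \sum_k g (x k) = n%:R * \sum_i etype x i * g i.
Proof.
move=> n0; rewrite (partition_big x xpredT)//= mulr_sumr.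
apply: eq_bigr => i _; rewrite (eq_bigr (fun=> g i)) => [|k /eqP-> //].
rewrite sumr_const -[LHS]mulr_natl mulrA /etype [n%:R * _]mulrC.
by rewrite divfK ?pnatr_eq0 -?lt0n.
Qed.

Lemma etype_distr x : (0 < n)%N -> distr (etype x).
Proof.
move=> n0; split=> [i|]; first by rewrite divr_ge0.
have /= := @sum_word_etype (fun=> 1) x n0.
rewrite sumr_const card_ord -[LHS]mulr1 => /mulfI; rewrite pnatr_eq0 -lt0n => /(_ n0) ->.
by apply: eq_bigr => i _; rewrite mulr1.
Qed.

Lemma etype_word_gt0 x k : 0 < etype x (x k).
Proof.
have n0 : (0 < n)%N by case: n k => // -[].
rewrite divr_gt0 ?ltr0n//; apply/card_gt0P; exists k; by rewrite inE.
Qed.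

Lemma etype_neq0P x i : etype x i != 0 -> exists k, x k = i.
Proof.
rewrite mulf_eq0 negb_or pnatr_eq0 -lt0n => /andP[/card_gt0P[k]].
by rewrite inE => /eqP <- _; exists k.
Qed.

Lemma pword_ge0 b x : (forall i, 0 <= b i) -> 0 <= pword b x.
Proof. by move=> b0; apply: prodr_ge0. Qed.

Lemma pword_expR b x : (forall k, 0 < b (x k)) ->
  pword b x = expR (\sum_k ln (b (x k))).
Proof.
by move=> b0; rewrite expR_sum; apply: eq_bigr => k _; rewrite lnK// posrE.
Qed.

Lemma sum_pword (f : 'I_d -> R) : \sum_x pword f x = (\sum_i f i) ^+ n.
Proof.
by rewrite /pword -(bigA_distr_bigA (fun _ i => f i)) prodr_const card_ord.
Qed.

Lemma pword_etype x : (0 < n)%N ->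
  pword (etype x) x = expR (- (n%:R * tentropy x)).
Proof.
move=> n0; rewrite pword_expR => [|k]; last exact: etype_word_gt0.
by rewrite (sum_word_etype (fun i => ln (etype x i)))// /tentropy /entropy mulrN opprK.
Qed.

(** Each summand is the probability of x under its own type. Summing over all count vectors c
    instead of the type of x only, and then over x first, every c that is a distribution contributes
    total mass 1, and there are at most (n+1)^d of them. *)
Lemma sum_types_le : (0 < n)%N ->
  \sum_x expR (- (n%:R * tentropy x)) <= n.+1%:R ^+ d.
Proof.
move=> n0.
pose T := {ffun 'I_d -> 'I_n.+1}.
pose ct (c : T) i : R := (c i)%:R / n%:R.
have hc x i : (#|[pred k | x k == i]| < n.+1)%N.
  by rewrite ltnS -[X in (_ <= X)%N]card_ord max_card.
pose c_ x : T := [ffun i => Ordinal (hc x i)].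
have ct0 (c : T) i : 0 <= ct c i by rewrite divr_ge0.
have ctx x : ct (c_ x) = etype x by apply/funext => i; rewrite /ct ffunE.
apply: (@le_trans _ _ (\sum_x \sum_(c : T | \sum_i ct c i == 1) pword (ct c) x)).
  apply: ler_sum => x _; rewrite -pword_etype// (bigD1 (c_ x))/=; last first.
    by rewrite ctx; have [_ ->] := etype_distr x n0.
  by rewrite ctx lerDl; apply: sumr_ge0 => c _; exact: pword_ge0.
rewrite exchange_big/=.
rewrite (eq_bigr (fun=> 1)); last by move=> c /eqP hs; rewrite sum_pword hs expr1n.
rewrite sumr_const -natrX ler_nat (leq_trans (max_card _))//.
by rewrite card_ffun !card_ord.
Qed.

Lemma tentropy_ge0 x : 0 <= tentropy x.
Proof.
(* For n = 0 the type is identically 0, by the convention on division by 0, and so is its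
   entropy. *)
have [n0|n0] := posnP n; last exact/entropy_ge0/etype_distr.
rewrite /tentropy /entropy big1 ?oppr0// => i _.
by rewrite /etype (_ : n%:R^-1 = 0 :> R) ?mulr0 ?mul0r// [X in X%:R]n0 invr0.
Qed.

Lemma tentropy_le_ln x : (0 < d)%N -> tentropy x <= ln d%:R.
Proof.
move=> d0; have [n0|n0] := posnP n; last exact/entropy_le_ln/etype_distr.
rewrite /tentropy /entropy big1 ?oppr0 => [|i _].
  by rewrite ln_ge0// ler1n.
by rewrite /etype (_ : n%:R^-1 = 0 :> R) ?mulr0 ?mul0r// [X in X%:R]n0 invr0.
Qed.

(** Each counted word contributes at least e^(-nt) to the sum in [sum_types_le]. *)
Lemma card_low_types (t : R) : (0 < n)%N ->
  #|[pred x : W | tentropy x <= t]|%:R <= n.+1%:R ^+ d * expR (n%:R * t).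
Proof.
move=> n0; rewrite -ler_pdivrMr ?expR_gt0// -expRN.
apply: le_trans (sum_types_le n0).
rewrite [leRHS](bigID (fun x => tentropy x <= t))/=.
apply: (@le_trans _ _ (\sum_(x | tentropy x <= t) expR (- (n%:R * t)))).
  by rewrite sumr_const -[leRHS]mulr_natl.
rewrite (@le_trans _ _ (\sum_(x | tentropy x <= t) expR (- (n%:R * tentropy x))))//.
  apply: ler_sum => x hx; rewrite ler_expR lerN2 ler_wpM2l//.
by rewrite lerDl; apply: sumr_ge0 => x _; exact: expR_ge0.
Qed.

Lemma pword_neq0 b x : pword b x != 0 -> forall k, b (x k) != 0.
Proof. by move=> /prodf_neq0 h k; exact: h. Qed.

(** A word of type b has probability e^(-n (H(b) + D(b||a))) under a. The divergence supplies the
    factor e^(-nM), and the entropies are summed by [sum_types_le]. *)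
Lemma type_tail a (t M : R) : (0 < n)%N -> distr a ->
  (forall b, distr b -> t < entropy b -> (M%:E <= relentropy b a)%E) ->
  \sum_(x | t < tentropy x) pword a x <= expR (- (n%:R * M)) * n.+1%:R ^+ d.
Proof.
move=> n0 [a0 a1] hM.
apply: (@le_trans _ _ (expR (- (n%:R * M)) * \sum_x expR (- (n%:R * tentropy x))));
  last by rewrite ler_wpM2l ?expR_ge0// sum_types_le.
rewrite mulr_sumr [leRHS](bigID (fun x => t < tentropy x))/=.
rewrite ler_wpDr//.
  by apply: sumr_ge0 => x _; rewrite mulr_ge0 ?expR_ge0.
apply: ler_sum => x hx.
have [->|/pword_neq0 hax] := eqVneq (pword a x) 0.
  by rewrite mulr_ge0 ?expR_ge0.
have {}hax k : 0 < a (x k) by rewrite lt_def hax a0.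
have := hM _ (etype_distr x n0) hx; rewrite /relentropy.
rewrite (eq_bigr (fun i => (etype x i * (ln (etype x i) - ln (a i)))%:E)); last first.
  move=> i _; case: eqP => [->|/eqP/etype_neq0P [k <-]]; first by rewrite mul0r.
  by rewrite gt_eqF// ln_div ?posrE// etype_word_gt0.
rewrite sumEFin lee_fin => hMD.
rewrite pword_expR// (sum_word_etype (fun i => ln (a i)))// -expRD ler_expR.
rewrite -opprD -mulrDr -mulrN ler_wpM2l//.
have e : \sum_(i < d) etype x i * (ln (etype x i) - ln (a i)) =
    - tentropy x - \sum_i etype x i * ln (a i).
  rewrite /tentropy /entropy opprK -sumrB; apply: eq_bigr => i _.
  by rewrite mulrBr.
by move: hMD; rewrite e; lra.
Qed.

(** By independence and centering, the mixed terms with k != l vanish in the expansion of the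
    square. *)
Lemma second_moment b (h : 'I_d -> R) : distr b -> \sum_i b i * h i = 0 ->
  \sum_x pword b x * (\sum_k h (x k)) ^+ 2 = n%:R * \sum_i b i * h i ^+ 2.
Proof.
move=> [b0 b1] h0.
have E k l : \sum_x pword b x * (h (x k) * h (x l)) =
    if k == l then \sum_i b i * h i ^+ 2 else 0.
  (* The factors h sit at the positions k and l only, so that the sum over words becomes a product
     over positions of sums over one letter. *)
  pose F j i := b i * (if j == k then h i else 1) * (if j == l then h i else 1).
  transitivity (\prod_j \sum_i F j i).
    rewrite bigA_distr_bigA; apply: eq_bigr => x _.
    rewrite /F !big_split/= mulrA; congr (_ * _ * _).
      by rewrite (bigD1 k)//= eqxx big1 ?mulr1// => j /negPf ->.
    by rewrite (bigD1 l)//= eqxx big1 ?mulr1// => j /negPf ->.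
  rewrite (bigD1 k)//= /F eqxx; case: (eqVneq k l) => [kl|kl].
    rewrite [X in _ * X]big1 ?mulr1.
      by apply: eq_bigr => i _; rewrite -mulrA expr2.
    move=> j /negPf jk; rewrite -kl jk -[RHS]b1.
    by apply: eq_bigr => i _; rewrite !mulr1.
  rewrite (_ : \sum_i _ = 0) ?mul0r// -[RHS]h0.
  by apply: eq_bigr => i _; rewrite mulr1.
transitivity (\sum_x \sum_k \sum_l pword b x * (h (x k) * h (x l))).
  apply: eq_bigr => x _; rewrite expr2 mulr_suml mulr_sumr.
  by apply: eq_bigr => k _; rewrite !mulr_sumr.
rewrite exchange_big/= (eq_bigr (fun=> \sum_i b i * h i ^+ 2)).
  by rewrite sumr_const card_ord mulr_natl.
move=> k _; rewrite exchange_big/= (bigD1 k)//= E eqxx [X in _ + X]big1 ?addr0// => l lk.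
by rewrite E eq_sym (negPf lk).
Qed.

Lemma chebyshev_words b (h : 'I_d -> R) (s : R) : distr b ->
  \sum_i b i * h i = 0 -> 0 < s ->
  \sum_(x : W | s <= `|\sum_k h (x k)|) pword b x
    <= n%:R * (\sum_i b i * h i ^+ 2) / s ^+ 2.
Proof.
move=> hb h0 s0; rewrite ler_pdivlMr ?exprn_gt0// -second_moment//.
rewrite mulr_suml [leRHS](bigID (fun x : W => s <= `|\sum_k h (x k)|))/=.
rewrite ler_wpDr//.
  by apply: sumr_ge0 => x _; rewrite mulr_ge0 ?sqr_ge0// pword_ge0//; case: hb.
apply: ler_sum => x hx; rewrite ler_wpM2l//; first by apply: pword_ge0; case: hb.
by rewrite -[leRHS]real_normK ?num_real// lerXn2r// qualifE/= ltW.
Qed.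

(** The varentropy: the variance of the information content -ln b under b. *)
Definition infovar b : R := \sum_i b i * (- ln (b i) - entropy b) ^+ 2.

Lemma info_centered b : distr b -> \sum_i b i * (- ln (b i) - entropy b) = 0.
Proof.
move=> [_ b1]; rewrite (eq_bigr (fun i => - (b i * ln (b i)) - b i * entropy b)).
  by rewrite sumrB -mulr_suml b1 mul1r sumrN subrr.
by move=> i _; rewrite mulrBr mulrN.
Qed.

(** By the Gibbs inequality n H(type of x) is at most -ln of the probability of x, so a large type
    entropy forces a large information content, which Chebyshev's inequality controls. *)
Lemma tentropy_concentration a (s : R) : (0 < n)%N -> distr a -> 0 < s ->
  \sum_(x : W | n%:R * entropy a + s < n%:R * tentropy x) pword a x
    <= n%:R * infovar a / s ^+ 2.
Proof.
move=> n0 ha s0; apply: le_trans (chebyshev_words ha (info_centered ha) s0).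
have [a0 a1] := ha.
rewrite big_mkcond [leRHS]big_mkcond/=; apply: ler_sum => x _.
have p0 : 0 <= pword a x by exact: pword_ge0.
case: ifPn => hx; last by case: ifP.
have [->|/pword_neq0 hax] := eqVneq (pword a x) 0; first by case: ifP.
rewrite ifT//; apply: le_trans (ler_norm _).
rewrite big_split/= sumr_const card_ord sumrN -mulr_natl mulrN lerBrDl.
apply: le_trans (ltW hx) _.
rewrite (sum_word_etype (fun i => ln (a i)))// -mulrN ler_wpM2l// lerNr.
have := @gibbs R d a _ (etype_distr x n0) a0; rewrite a1 lexx => /(_ isT).
rewrite /tentropy /entropy opprK; apply => i /etype_neq0P[k <-]; exact: hax.
Qed.

(** Atypical words are handled by Chebyshev's inequality, and a typical word has probability at most
    e^(s - n H(b)). So a test q with small total weight captures little of the mass of b. *)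
Lemma typical_mass_le b (q : W -> R) (s : R) : distr b -> 0 < s ->
  (forall x, 0 <= q x <= 1) ->
  \sum_x pword b x * q x <=
    n%:R * infovar b / s ^+ 2 + expR (s - n%:R * entropy b) * \sum_x q x.
Proof.
move=> hb s0 hq; have [b0 b1] := hb.
rewrite (bigID (fun x : W => s <= `|\sum_k (- ln (b (x k)) - entropy b)|))/=.
rewrite lerD//.
  apply: le_trans (chebyshev_words hb (info_centered hb) s0).
  apply: ler_sum => x _; rewrite ler_piMr ?pword_ge0//; by case/andP: (hq x).
rewrite mulr_sumr big_mkcond/=; apply: ler_sum => x _.
have /andP[q0 _] := hq x.
case: ifPn => [hx|_]; last by rewrite mulr_ge0 ?expR_ge0.
rewrite ler_wpM2r//.
have [->|/pword_neq0 hbx] := eqVneq (pword b x) 0; first exact: expR_ge0.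
rewrite pword_expR => [|k]; last by rewrite lt_def hbx b0.
rewrite ler_expR; move: hx; rewrite -ltNge ltr_norml => /andP[+ _].
rewrite big_split/= sumr_const card_ord sumrN -[- entropy b *+ n]mulr_natl => hx.
lra.
Qed.

(** The value of [relentropy] when b is supported in the support of a; [llrvar] is the variance of
    the log-likelihood ratio under b. *)
Definition realent b a : R := \sum_i b i * ln (b i / a i).
Definition llrvar b a : R := \sum_i b i * (ln (b i / a i) - realent b a) ^+ 2.

(** Outside a set whose b-mass is bounded by Chebyshev's inequality, the log-likelihood ratio of a
    word is below n D(b||a) + s, so there its a-probability is at least e^(-n D - s) times its
    b-probability. *)
Lemma change_of_measure a b (q : W -> R) (s : R) : distr b ->
  (forall i, 0 <= a i) -> (forall i, b i != 0 -> a i != 0) -> 0 < s ->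
  (forall x, 0 <= q x <= 1) ->
  expR (- (n%:R * realent b a) - s) *
    (\sum_x pword b x * q x - n%:R * llrvar b a / s ^+ 2)
  <= \sum_x pword a x * q x.
Proof.
move=> hb a0 ba s0 hq; have [b0 b1] := hb.
have hc : \sum_i b i * (ln (b i / a i) - realent b a) = 0.
  rewrite (eq_bigr (fun i => b i * ln (b i / a i) - b i * realent b a)).
    by rewrite sumrB -mulr_suml b1 mul1r subrr.
  by move=> i _; rewrite mulrBr.
have hcheb := @chebyshev_words b _ s hb hc s0; rewrite -/(llrvar b a) in hcheb.
rewrite -ler_pdivlMl ?expR_gt0// -expRN opprB opprK.
rewrite lerBlDr (bigID (fun x : W => s <= `|\sum_k (ln (b (x k) / a (x k)) - realent b a)|))/=.
rewrite addrC lerD//; last first.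
  apply: le_trans hcheb.
  apply: ler_sum => x _; rewrite ler_piMr ?pword_ge0//; by case/andP: (hq x).
rewrite mulr_sumr big_mkcond/=; apply: ler_sum => x _.
have /andP[q0 _] := hq x.
case: ifPn => [hx|_]; last by rewrite !mulr_ge0 ?expR_ge0// pword_ge0.
rewrite mulrA ler_wpM2r//.
have [->|/pword_neq0 hbx] := eqVneq (pword b x) 0.
  by rewrite mulr_ge0 ?expR_ge0// pword_ge0.
have hbp k : 0 < b (x k) by rewrite lt_def hbx b0.
have hap k : 0 < a (x k) by rewrite lt_def ba// a0.
rewrite !pword_expR// -expRD ler_expR; move: hx; rewrite -ltNge ltr_norml => /andP[_].
rewrite big_split/= sumr_const card_ord -[- realent b a *+ n]mulr_natl.
rewrite (eq_bigr (fun k => ln (b (x k)) - ln (a (x k)))); last first.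
  by move=> k _; rewrite ln_div// posrE.
rewrite sumrB => hx; lra.
Qed.

End Types.

(** * Orthogonal projectors onto row spaces *)

Section OrthoProj.
Variable C : numClosedFieldType.

Definition onb m n (V : 'M[C]_(m, n)) : 'M[C]_(\rank V, n) := schmidt (row_base V).

(** Subspaces are row spaces, so this projector acts on row vectors from the right. *)
Definition oproj m n (V : 'M[C]_(m, n)) : 'M[C]_n := (onb V)^t* *m onb V.

Lemma onb_mul_adj m n (V : 'M[C]_(m, n)) : onb V *m (onb V)^t* = 1%:M.
Proof. by apply/unitarymxP/schmidt_unitarymx/rank_leq_col. Qed.

Lemma onb_eqmx m n (V : 'M[C]_(m, n)) : (onb V :=: V)%MS.
Proof.
apply: eqmx_trans (eq_row_base V).
by apply: eqmx_schmidt_free; exact: row_base_free.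
Qed.

Lemma oproj_proj m n (V : 'M[C]_(m, n)) : is_proj (oproj V).
Proof.
split; first by rewrite /oproj mulmx_adj trmxCK.
by rewrite /oproj mulmxA -(mulmxA _ (onb V)) onb_mul_adj mulmx1.
Qed.

Lemma oproj_id p m n (A : 'M[C]_(p, n)) (V : 'M[C]_(m, n)) :
  (A <= V)%MS -> A *m oproj V = A.
Proof.
rewrite -(onb_eqmx V) => /submxP[D ->].
by rewrite /oproj mulmxA -(mulmxA D) onb_mul_adj mulmx1.
Qed.

Lemma oproj_subl m m' n (V : 'M[C]_(m, n)) (V' : 'M[C]_(m', n)) :
  (V <= V')%MS -> oproj V *m oproj V' = oproj V.
Proof.
by move=> h; rewrite /oproj -mulmxA (oproj_id (A := onb V))// onb_eqmx.
Qed.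

Lemma oproj_subr m m' n (V : 'M[C]_(m, n)) (V' : 'M[C]_(m', n)) :
  (V <= V')%MS -> oproj V' *m oproj V = oproj V.
Proof.
move=> h; have [h1 _] := oproj_proj V; have [h2 _] := oproj_proj V'.
by rewrite -{1}h1 -{1}h2 -mulmx_adj oproj_subl.
Qed.

Lemma oproj_diff m m' n (V : 'M[C]_(m, n)) (V' : 'M[C]_(m', n)) :
  (V <= V')%MS -> is_proj (oproj V' - oproj V).
Proof.
move=> h; have [h1 p1] := oproj_proj V; have [h2 p2] := oproj_proj V'.
split; first by rewrite adjB h1 h2.
rewrite mulmxBl !mulmxBr (oproj_subl h) (oproj_subr h) p1 p2.
by rewrite subrr subr0.
Qed.

Lemma tr_oproj m n (V : 'M[C]_(m, n)) : \tr (oproj V) = (\rank V)%:R.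
Proof. by rewrite /oproj mxtrace_mulC onb_mul_adj mxtrace1. Qed.

End OrthoProj.

(** * Tensor powers and the universal subspaces *)

Section TensorPower.
Variables (C : numClosedFieldType) (d n : nat).
Local Notation W := {ffun 'I_n -> 'I_d}.
Local Notation K := (tdim d n).

Definition wd (i : 'I_K) : W := enum_val i.
Definition wi (x : W) : 'I_K := enum_rank x.

Lemma wdK : cancel wd wi. Proof. exact: enum_valK. Qed.
Lemma wiK : cancel wi wd. Proof. exact: enum_rankK. Qed.

Lemma sum_wd (V : nmodType) (F : W -> V) : \sum_i F (wd i) = \sum_x F x.
Proof. by rewrite [RHS](reindex wd)//; exists wi => x _; rewrite ?wdK ?wiK. Qed.

Definition tpow (A : 'I_n -> 'M[C]_d) : 'M[C]_K :=
  \matrix_(i, j) \prod_k A k (wd i k) (wd j k).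

Lemma tpowM A B : tpow A *m tpow B = tpow (fun k => A k *m B k).
Proof.
apply/matrixP => i j; rewrite !mxE.
transitivity (\sum_l \prod_k (A k (wd i k) (wd l k) * B k (wd l k) (wd j k))).
  by apply: eq_bigr => l _; rewrite !mxE big_split.
rewrite (sum_wd (fun x : W => \prod_k (A k (wd i k) (x k) * B k (x k) (wd j k)))).
rewrite -(bigA_distr_bigA (fun k y => A k (wd i k) y * B k y (wd j k))).
by apply: eq_bigr => k _; rewrite mxE.
Qed.

Lemma tpow_adj A : (tpow A)^t* = tpow (fun k => (A k)^t* ).
Proof.
apply/matrixP => i j; rewrite !mxE rmorph_prod.
by apply: eq_bigr => k _; rewrite !mxE.
Qed.

Lemma tpow_diag (s : 'I_n -> 'rV[C]_d) :
  tpow (fun k => diag_mx (s k)) = diag_mx (\row_i \prod_k s k ord0 (wd i k)).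
Proof.
apply/matrixP => i j; rewrite !mxE; have [<-|ij] := eqVneq i j.
  by rewrite mulr1n; apply: eq_bigr => k _; rewrite mxE eqxx mulr1n.
have [k hk] : exists k, wd i k != wd j k.
  apply/existsP; apply: contraNT ij => /existsPn h.
  rewrite -(inj_eq (can_inj wdK)); apply/eqP/ffunP => k.
  by apply/eqP; have := h k; rewrite negbK.
by rewrite mulr0n (bigD1 k)//= mxE (negPf hk) mulr0n mul0r.
Qed.

Lemma tpow1 : tpow (fun=> 1%:M) = 1%:M.
Proof.
rewrite (_ : (fun=> 1%:M) = (fun=> diag_mx (const_mx 1))); last first.
  by apply/funext => k; rewrite diag_const_mx.
rewrite tpow_diag -diag_const_mx; congr diag_mx; apply/rowP => i; rewrite !mxE.
by rewrite big1// => k _; rewrite mxE.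
Qed.

Lemma tpow_unitary (U : 'I_n -> 'M[C]_d) : (forall k, U k \is unitarymx) ->
  tpow U \is unitarymx.
Proof.
move=> hU; apply/unitarymxP; rewrite tpow_adj tpowM -tpow1; congr tpow.
by apply/funext => k; exact/unitarymxP.
Qed.

Local Notation jtype := {ffun 'I_d * 'I_d -> 'I_n.+1}.

Definition jcount (x y : W) (u : 'I_d * 'I_d) : nat := #|[pred k | (x k, y k) == u]|.

Definition jmx (c : jtype) : 'M[C]_K :=
  \matrix_(i, j) [forall u, jcount (wd i) (wd j) u == c u]%:R.

(* The entries of a tensor power A^(x)n are monomials in the entries of A
   determined by the joint type of the indices; so all tensor powers lie in the
   span of polynomially many matrices. *)
Lemma tpow_jmx (A : 'M[C]_d) :
  tpow (fun=> A) = \sum_(c : jtype) (\prod_u A u.1 u.2 ^+ c u) *: jmx c.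
Proof.
apply/matrixP => i j; rewrite summxE mxE.
have hc u : (jcount (wd i) (wd j) u < n.+1)%N.
  by rewrite ltnS -[X in (_ <= X)%N]card_ord max_card.
pose c0 : jtype := [ffun u => Ordinal (hc u)].
rewrite (bigD1 c0)//= [X in _ + X]big1 ?addr0 => [|c cc0]; last first.
  rewrite !mxE; case: forallP => [h|_]; last by rewrite mulr0.
  case/eqP: cc0; apply/ffunP => u; apply/val_inj; rewrite ffunE/=.
  by have /eqP := h u.
rewrite !mxE; case: forallP => [_|[]]; last by move=> u; rewrite ffunE.
rewrite mulr1 (partition_big (fun k => (wd i k, wd j k)) xpredT)//=.
apply: eq_bigr => u _; rewrite ffunE/= -prodr_const.
by apply: eq_bigr => k /eqP <-.
Qed.

Definition predmx (T : pred W) : 'M[C]_K := diag_mx (\row_i (T (wd i))%:R).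

(** The space V_t of the idea above, in row form and for a general set T of words. It is built from
    joint types alone, hence independent of any eigenbasis. *)
Definition symspan (T : pred W) : 'M[C]_K := (\sum_(c : jtype) (predmx T *m jmx c))%MS.

Lemma tpow_symspan T (A : 'M[C]_d) : (predmx T *m tpow (fun=> A) <= symspan T)%MS.
Proof.
rewrite tpow_jmx mulmx_sumr; apply: summx_sub => c _.
by rewrite -scalemxAr scalemx_sub// (sumsmx_sup c).
Qed.

Lemma symspan_sub (T T' : pred W) : {subset T <= T'} -> (symspan T <= symspan T')%MS.
Proof.
move=> TT'; apply/sumsmx_subP => c _; apply: (sumsmx_sup c) => //.
have -> : predmx T *m jmx c = predmx T *m (predmx T' *m jmx c).
  rewrite mulmxA mulmx_diag; congr (diag_mx _ *m _); apply/rowP => i; rewrite !mxE.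
  case: (boolP (T (wd i))) => [/TT' h|_]; last by rewrite mul0r.
  by rewrite (_ : T' (wd i) = true) ?mulr1.
exact: submxMl.
Qed.

Lemma rank_predmx (T : pred W) : (\rank (predmx T) <= #|T|)%N.
Proof.
have -> : predmx T = \sum_(x in T) delta_mx (wi x) (wi x).
  apply/matrixP => i j; rewrite summxE !mxE.
  rewrite big_mkcond/= (bigD1 (wd i))//= big1 ?addr0 => [|x xi]; last first.
    case: ifP => // _; rewrite !mxE; case: eqP => //= ix.
    by rewrite ix wiK eqxx in xi.
  rewrite unfold_in; case: (T (wd i)); last by rewrite mul0rn.
  by rewrite !mxE wdK eqxx/= eq_sym.
rewrite -sum1_card; elim/big_rec2: _ => [|x r A _ IH]; first by rewrite mxrank0.
by rewrite (leq_trans (mxrank_add _ _))// leq_add// mxrank_delta.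
Qed.

Lemma rank_symspan (T : pred W) : (\rank (symspan T) <= n.+1 ^ (d * d) * #|T|)%N.
Proof.
apply: (@leq_trans (\sum_(c : jtype) #|T|)); last first.
  by rewrite sum_nat_const card_ffun card_prod !card_ord.
rewrite /symspan; elim/big_rec2: _ => [|c r A _ IH]; first by rewrite mxrank0.
rewrite (leq_trans (mxrank_adds_leqif _ _))// leq_add//.
by rewrite (leq_trans (mxrankM_maxl _ _))// rank_predmx.
Qed.

Lemma symspanT (T : pred W) : (forall x, T x) -> (1%:M <= symspan T)%MS.
Proof.
move=> hT; rewrite -{1}tpow1 -[tpow _]mul1mx.
have -> : 1%:M = predmx T; last exact: tpow_symspan.
by rewrite -diag_const_mx; congr diag_mx; apply/rowP => i; rewrite !mxE hT.
Qed.

Lemma oproj_symspanT (T : pred W) : (forall x, T x) -> oproj (symspan T) = 1%:M.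
Proof. by move=> hT; rewrite -[LHS]mul1mx oproj_id// symspanT. Qed.

Lemma symspan0 (T : pred W) : (forall x, ~~ T x) -> oproj (symspan T) = 0.
Proof.
move=> hT; rewrite /oproj; suff -> : onb (symspan T) = 0 by rewrite mulmx0.
apply/eqP; rewrite -submx0 onb_eqmx; apply/sumsmx_subP => c _.
suff -> : predmx T = 0 by rewrite mul0mx sub0mx.
by apply/matrixP => i j; rewrite !mxE (negPf (hT _)) mul0rn.
Qed.

(** The identity is a tensor power, so its row at x, a unit vector, lies in the span. *)
Lemma rank_symspan_gt0 (T : pred W) x : T x -> (0 < \rank (symspan T))%N.
Proof.
move=> Tx; rewrite lt0n mxrank_eq0; apply/eqP => h0.
have := tpow_symspan T 1%:M; rewrite h0 tpow1 mulmx1 submx0 => /eqP/matrixP/(_ (wi x) (wi x)).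
by rewrite !mxE wiK Tx eqxx => /eqP; rewrite oner_eq0.
Qed.

Section Spectral.
Variables (rho : 'M[C]_d) (hrho : psd rho).
Let U := tpow (fun=> spectralmx rho).

(** The diagonal of M in the product eigenbasis of rho, indexed by words. *)
Definition qdiag (M : 'M[C]_K) (x : W) : C := (U *m M *m U^t*) (wi x) (wi x).

Lemma tpow_spectral_unitary : U \is unitarymx.
Proof. by apply: tpow_unitary => k; exact: spectral_unitarymx. Qed.

(** Makes the problem classical: only the diagonal of M in the product eigenbasis matters, as a test
    function on i.i.d. words drawn from the spectrum of rho. *)
Lemma tr_tpow_mul (M : 'M[C]_K) : \tr (tpow (fun=> rho) *m M) =
  \sum_(x : W) (\prod_k spectral_diag rho ord0 (x k)) * qdiag M x.
Proof.
have -> : tpow (fun=> rho) = U^t* *m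
    diag_mx (\row_i \prod_k spectral_diag rho ord0 (wd i k)) *m U.
  rewrite -(tpow_diag (fun=> spectral_diag rho)) /U tpow_adj !tpowM; congr tpow.
  by apply/funext => k; exact: psd_spectral.
rewrite -!mulmxA mxtrace_mulC -!mulmxA [U *m (M *m _)]mulmxA.
rewrite /mxtrace -sum_wd; apply: eq_bigr => i _.
by rewrite mul_diag_mx mxE [(\row_ _ _) _ _]mxE /qdiag wdK.
Qed.

Lemma sum_qdiag M : \sum_x qdiag M x = \tr M.
Proof.
rewrite -sum_wd; under eq_bigr do rewrite /qdiag wdK.
rewrite -/(mxtrace _) mxtrace_mulC mulmxA.
by rewrite (unitary_mulVmx tpow_spectral_unitary) mul1mx.
Qed.

Lemma qdiag_ge0 M x : psd M -> 0 <= qdiag M x.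
Proof.
move=> hM; rewrite /qdiag -{1}[U](trmxCK U).
by apply: psd_diag_ge0; exact: psd_congr.
Qed.

Lemma qdiagB M N x : qdiag (M - N) x = qdiag M x - qdiag N x.
Proof. by rewrite /qdiag mulmxBr mulmxBl !mxE. Qed.

Lemma qdiag1 x : qdiag 1%:M x = 1.
Proof.
by rewrite /qdiag mulmx1 (unitary_mulmxV tpow_spectral_unitary) mxE eqxx.
Qed.

(** The source of universality: the eigenvector labelled x is a row of a tensor power, so it lies in
    [symspan T] whatever the state rho, and the projector fixes it. *)
Lemma qdiag_oproj (T : pred W) x : T x -> qdiag (oproj (symspan T)) x = 1.
Proof.
move=> Tx; rewrite -(qdiag1 x) /qdiag mulmx1.
have h : predmx T *m U *m oproj (symspan T) = predmx T *m U.
  by apply: oproj_id; exact: tpow_symspan.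
have e (M : 'M[C]_K) : (U *m M) (wi x) = (predmx T *m U *m M) (wi x).
  by apply/funext => j; rewrite -mulmxA mul_diag_mx !mxE wiK Tx mul1r.
rewrite ![(_ *m U^t*) _ _]mxE; apply: eq_bigr => j _; congr (_ * _).
by rewrite e h mul_diag_mx !mxE wiK Tx mul1r.
Qed.

End Spectral.
End TensorPower.

(** * Unordered sums of signed real families *)

Section Summation.
Variables (R : realType) (T : choiceType) (D : set T).
Implicit Types f g h : T -> R.

(** Any splitting into nonnegative parts with finite sums is accepted as a witness, which makes
    linearity easy; [hrsum_rsum] shows that the value does not depend on the splitting. *)
Definition hrsum f (s : R) := exists g h G H,
  [/\ forall x, D x -> 0 <= g x, forall x, D x -> 0 <= h x,
      forall x, D x -> f x = g x - h x &
   [/\ (\esum_(x in D) (g x)%:E = G%:E)%E, (\esum_(x in D) (h x)%:E = H%:E)%E &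
      s = G - H]].

Lemma hrsum_rsum f s : hrsum f s -> rsum D f = s.
Proof.
move=> [g [h [G [H [g0 h0 fE [hG hH ->]]]]]].
have sg : summable D (EFin \o g).
  rewrite /summable (eq_esum (b := EFin \o g)) => [|x Dx]; first by rewrite hG ltry.
  by rewrite gee0_abs// lee_fin g0.
have sh : summable D (EFin \o h).
  rewrite /summable (eq_esum (b := EFin \o h)) => [|x Dx]; first by rewrite hH ltry.
  by rewrite gee0_abs// lee_fin h0.
have e := esumB sg sh (fun x Dx => g0 x Dx) (fun x Dx => h0 x Dx).
rewrite /rsum.
rewrite (eq_esum (b := ((EFin \o g) \- (EFin \o h))^\+%E)); last first.
  by move=> x Dx; rewrite !funeposE/= fE.
rewrite (eq_esum (a := (EFin \o f)^\-%E) (b := ((EFin \o g) \- (EFin \o h))^\-%E)); last first.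
  by move=> x Dx; rewrite !funenegE/= fE.
by rewrite e hG hH.
Qed.

Lemma hrsum_ge0 f s : (forall x, D x -> 0 <= f x) -> hrsum f s ->
  (\esum_(x in D) (f x)%:E = s%:E)%E.
Proof.
move=> f0 [g [h [G [H [g0 h0 fE [hG hH ->]]]]]].
have : (\esum_(x in D) (g x)%:E = \esum_(x in D) (f x)%:E + \esum_(x in D) (h x)%:E)%E.
  rewrite -esumD; [|by move=> x Dx; rewrite lee_fin f0|by move=> x Dx; rewrite lee_fin h0].
  by apply: eq_esum => x Dx; rewrite -EFinD fE// subrK.
rewrite hG hH => e; rewrite EFinB e addeK//.
Qed.

Lemma hrsumD f1 f2 s1 s2 : hrsum f1 s1 -> hrsum f2 s2 ->
  hrsum (fun x => f1 x + f2 x) (s1 + s2).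
Proof.
move=> [g [h [G [H [g0 h0 fE [hG hH ->]]]]]] [g' [h' [G' [H' [g0' h0' fE' [hG' hH' ->]]]]]].
exists (fun x => g x + g' x), (fun x => h x + h' x), (G + G'), (H + H'); split.
- by move=> x Dx; rewrite addr_ge0 ?g0 ?g0'.
- by move=> x Dx; rewrite addr_ge0 ?h0 ?h0'.
- by move=> x Dx; rewrite fE// fE'//; ring.
split; last by ring.
- by rewrite EFinD -hG -hG' -esumD// => x Dx; rewrite lee_fin ?g0 ?g0'.
- by rewrite EFinD -hH -hH' -esumD// => x Dx; rewrite lee_fin ?h0 ?h0'.
Qed.

(** One inequality comes from finite partial sums; the other is the same inequality for the factor
    c^-1. *)
Lemma esumZ (c : R) g : 0 <= c -> (forall x, D x -> 0 <= g x) ->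
  (\esum_(x in D) (c * g x)%:E = c%:E * \esum_(x in D) (g x)%:E)%E.
Proof.
move=> c0 g0; have [->|cn0] := eqVneq c 0.
  by rewrite mul0e esum1// => x _; rewrite mul0r.
have le (a : R) (u : T -> R) : 0 < a ->
    (\esum_(x in D) (a * u x)%:E <= a%:E * \esum_(x in D) (u x)%:E)%E.
  move=> a0; apply: ge_ereal_sup => _ [X [finX XD] <-].
  rewrite fsbig_finite//= sumEFin -mulr_sumr EFinM lee_pmul2l//.
  by apply: esum_ge; exists X => //; rewrite fsbig_finite//= sumEFin.
have cp : 0 < c by rewrite lt_def cn0.
apply/eqP; rewrite eq_le le//=.
rewrite -lee_pdivlMl//.
rewrite -[leLHS](eq_esum (a := fun x => (c^-1 * (c * g x))%:E)); last first.
  by move=> x Dx; rewrite mulKf.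
by apply: le; rewrite invr_gt0.
Qed.

Lemma hrsumZ (c : R) f s : hrsum f s -> hrsum (fun x => c * f x) (c * s).
Proof.
move=> [g [h [G [H [g0 h0 fE [hG hH ->]]]]]].
have [c0|c0] := leP 0 c.
  exists (fun x => c * g x), (fun x => c * h x), (c * G), (c * H); split.
  - by move=> x Dx; rewrite mulr_ge0// g0.
  - by move=> x Dx; rewrite mulr_ge0// h0.
  - by move=> x Dx; rewrite fE// mulrBr.
  by split; [rewrite esumZ// hG|rewrite esumZ// hH|rewrite mulrBr].
have nc0 : 0 <= - c by rewrite oppr_ge0 ltW.
exists (fun x => - c * h x), (fun x => - c * g x), (- c * H), (- c * G); split.
- by move=> x Dx; rewrite mulr_ge0// h0.
- by move=> x Dx; rewrite mulr_ge0// g0.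
- by move=> x Dx; rewrite fE//; ring.
by split; [rewrite esumZ// hH|rewrite esumZ// hG|ring].
Qed.

Lemma hrsum_eq f f' s s' : (forall x, D x -> f x = f' x) -> s = s' ->
  hrsum f s -> hrsum f' s'.
Proof.
move=> ff <- [g [h [G [H [g0 h0 fE hGH]]]]].
by exists g, h, G, H; split=> // x Dx; rewrite -ff// fE.
Qed.

Lemma hrsum0 : hrsum (fun=> 0) 0.
Proof.
by exists (fun=> 0), (fun=> 0), 0, 0; split=> //;
  [move=> x _; rewrite subrr|split; rewrite ?subrr// esum1].
Qed.

Lemma hrsum_sum (I : Type) (r : seq I) (P : pred I) (F : I -> T -> R) (s : I -> R) :
  (forall i, P i -> hrsum (F i) (s i)) ->
  hrsum (fun x => \sum_(i <- r | P i) F i x) (\sum_(i <- r | P i) s i).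
Proof.
move=> hF; elim: r => [|i r IH].
  by apply: hrsum_eq hrsum0 => [x _|]; rewrite big_nil.
rewrite big_cons; case: (boolP (P i)) => Pi.
  by apply: hrsum_eq (hrsumD (hF i Pi) IH) => [x _|//]; rewrite big_cons Pi.
by apply: hrsum_eq IH => [x _|//]; rewrite big_cons (negPf Pi).
Qed.

(** Split p u as p (M + u) - M p: both parts are nonnegative, with sums at most 2M and equal to
    M. *)
Lemma hrsum_bounded (p u : T -> R) (M : R) : (forall x, D x -> 0 <= p x) ->
  (\esum_(x in D) (p x)%:E = 1)%E -> (forall x, D x -> `|u x| <= M) ->
  hrsum (fun x => p x * u x) (rsum D (fun x => p x * u x)).
Proof.
move=> p0 p1 uM.
(* A point of D is what yields 0 <= M; an empty D would contradict the total mass 1. *)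
have [[x Dx]|nD] := pselect (exists x, D x); last first.
  have e : \esum_(x in D) (p x)%:E = 0%E.
    by rewrite esum1// => x Dx; case: nD; exists x.
  by move: p1; rewrite e => /eqP; rewrite eqe eq_sym oner_eq0.
have M0 : 0 <= M by exact: le_trans (normr_ge0 _) (uM _ Dx).
pose g x := p x * (M + u x).
have g0 y : D y -> 0 <= g y.
  move=> Dy; rewrite mulr_ge0 ?p0//.
  by have := uM y Dy; rewrite ler_norml => /andP[h _]; lra.
have hfin : (\esum_(x in D) (g x)%:E <= (2 * M)%:E)%E.
  apply: (@le_trans _ _ (\esum_(x in D) (2 * M * p x)%:E)%E).
    apply: le_esum => y Dy; rewrite lee_fin /g mulrC ler_wpM2r ?p0//.
    by have := uM y Dy; rewrite ler_norml => /andP[_ h]; lra.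
  by rewrite esumZ ?p1 ?mule1// mulr_ge0.
have gfin : (\esum_(x in D) (g x)%:E)%E \is a fin_num.
  rewrite ge0_fin_numE; first exact: le_lt_trans hfin (ltry _).
  by apply: esum_ge0 => y Dy; rewrite lee_fin g0.
have h : hrsum (fun x => p x * u x) (fine (\esum_(x in D) (g x)%:E)%E - M).
  exists g, (fun x => M * p x), (fine (\esum_(x in D) (g x)%:E)%E), M; split=> //.
  - by move=> y Dy; rewrite mulr_ge0// p0.
  - by move=> y Dy; rewrite /g; ring.
  - by split=> //; [rewrite fineK|rewrite esumZ// p1 mule1].
by rewrite (hrsum_rsum h).
Qed.

End Summation.

(** Writing A as a Gram matrix, 2 |A i j| <= A i i + A j j, and each diagonal entry is at most the
    trace. This bounds density matrices entrywise, so that their averages converge. *)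
Lemma psd_entry_le (C : numClosedFieldType) d (A : 'M[C]_d) i j :
  psd A -> \tr A = 1 -> `|A i j| <= 1.
Proof.
move=> hA trA; have hS := psdsqrt_psd hA.
set S := psdsqrt A in hS.
have AE k l : A k l = \sum_m (S m k)^*%R * S m l.
  rewrite -(psdsqrt_sqr hA) -/S -{1}(psd_herm hS) mxE.
  by apply: eq_bigr => m _; rewrite !mxE.
have Akk k : A k k = \sum_m `|S m k| ^+ 2.
  by rewrite AE; apply: eq_bigr => m _; rewrite normCK mulrC.
have Akk1 k : A k k <= 1.
  rewrite -trA /mxtrace (bigD1 k)//= lerDl; apply: sumr_ge0 => l _.
  exact: psd_diag_ge0.
have : 2 * `|A i j| <= A i i + A j j.
  rewrite AE; apply: le_trans (_ : 2 * (\sum_m `|(S m i)^*%R * S m j|) <= _).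
    by rewrite ler_wpM2l// ler_norm_sum.
  rewrite !Akk -big_split mulr_sumr; apply: ler_sum => m _ /=.
  rewrite normrM norm_conjC -subr_ge0.
  have -> : `|S m i| ^+ 2 + `|S m j| ^+ 2 - 2 * (`|S m i| * `|S m j|) =
    (`|S m i| - `|S m j|) ^+ 2 by ring.
  by rewrite real_exprn_even_ge0// rpredB// normr_real.
move=> /le_trans/(_ (lerD (Akk1 i) (Akk1 j))).
by rewrite -[1 + 1]mulr1 ler_pM2l.
Qed.

(** * Averaging over the source and over words *)

Section Average.
Variables (R : realType) (d : nat).
Local Notation C := R[i].
Variables (p : 'M[C]_d -> R) (hp : source p).
Local Notation D := (@density R d).

(** The intended [f] are the real-linear functionals: the property is checked on real and imaginary
    parts of entries and is closed under sums and scalings. *)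
Definition avglin (f : 'M[C]_d -> R) :=
  hrsum D (fun rho => p rho * f rho) (f (avgstate p)).

Lemma avglinD f g : avglin f -> avglin g -> avglin (fun x => f x + g x).
Proof.
by move=> hf hg; apply: hrsum_eq (hrsumD hf hg) => // x _; rewrite mulrDr.
Qed.

Lemma avglinZ c f : avglin f -> avglin (fun x => c * f x).
Proof.
by move=> hf; apply: hrsum_eq (hrsumZ c hf) => // x _; rewrite mulrCA.
Qed.

Lemma avglin_eq f g : f =1 g -> avglin f -> avglin g.
Proof. by move=> /funext ->. Qed.

Lemma avglin_sum (I : Type) (r : seq I) (P : pred I) (F : I -> 'M[C]_d -> R) :
  (forall i, P i -> avglin (F i)) -> avglin (fun x => \sum_(i <- r | P i) F i x).
Proof.
move=> hF; apply: hrsum_eq (hrsum_sum r hF) => // x _.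
by rewrite mulr_sumr.
Qed.

Lemma density_entry_le (rho : 'M[C]_d) i j : density rho -> `|rho i j| <= 1.
Proof. by move=> [h1 h2]; exact: psd_entry_le h1 h2. Qed.

Lemma avglin_Re i j : avglin (fun rho => complex.Re (rho i j)).
Proof.
have [p0 p1] := hp.
rewrite /avglin [avgstate p i j]mxE.
apply: (@hrsum_bounded _ _ _ p (fun rho => complex.Re (rho i j)) 1) => // x Dx; rewrite -lecR; apply: le_trans (normc_ge_Re _) _.
exact: density_entry_le.
Qed.

Lemma avglin_Im i j : avglin (fun rho => complex.Im (rho i j)).
Proof.
have [p0 p1] := hp.
rewrite /avglin [avgstate p i j]mxE.
apply: (@hrsum_bounded _ _ _ p (fun rho => complex.Im (rho i j)) 1) => // x Dx.
have h := density_entry_le i j Dx.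
rewrite -lecR -normrN -ReiNIm; apply: le_trans (normc_ge_Re _) _.
rewrite normrM [`|'i%C|]normc_def/= expr0n expr1n add0r sqrtr1 mulr1.
exact: h.
Qed.

Lemma avglin_mul (c : C) i j : avglin (fun rho => complex.Re (c * rho i j)).
Proof.
apply: avglin_eq (avglinD (avglinZ (complex.Re c) (avglin_Re i j))
  (avglinZ (- complex.Im c) (avglin_Im i j))) => rho.
by case: c (rho i j) => a b [u v] /=; rewrite mulNr.
Qed.

Lemma avglin_trmul (B : 'M[C]_d) : avglin (fun rho => complex.Re (\tr (B *m rho))).
Proof.
apply: avglin_eq (avglin_sum (index_enum 'I_d) (P := xpredT) (F := fun i rho =>
  \sum_j complex.Re (B i j * rho j i)) _) => [rho|i _].
  rewrite /mxtrace raddf_sum; apply: eq_bigr => i _.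
  by rewrite mxE raddf_sum.
by apply: avglin_sum => j _; exact: avglin_mul.
Qed.

Lemma avglin_ge0 f : (forall rho, density rho -> 0 <= f rho) -> avglin f ->
  (\esum_(rho in D) (p rho * f rho)%:E = (f (avgstate p))%:E)%E.
Proof.
move=> f0; apply: hrsum_ge0 => rho hrho; rewrite mulr_ge0 ?f0//.
by case: hp => + _; apply.
Qed.

Lemma avglin_avg_ge0 f : (forall rho, density rho -> 0 <= f rho) -> avglin f ->
  0 <= f (avgstate p).
Proof.
move=> f0 /(avglin_ge0 f0) h; rewrite -lee_fin -h esum_ge0// => rho hrho.
by rewrite lee_fin mulr_ge0 ?f0//; case: hp => + _; apply.
Qed.

Lemma avglin_avg_const f c : (forall rho, density rho -> f rho = c) -> avglin f ->
  f (avgstate p) = c.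
Proof.
move=> fc hf; have [p0 p1] := hp.
have base : hrsum D p 1.
  exists p, (fun=> 0), 1, 0; split=> //; first by move=> x _; rewrite subr0.
  by split; rewrite ?subr0// esum1.
have h : hrsum D (fun rho => p rho * f rho) c.
  apply: hrsum_eq (hrsumZ c base) => [rho hr|]; last by rewrite mulr1.
  by rewrite fc// mulrC.
by rewrite -(hrsum_rsum hf) (hrsum_rsum h).
Qed.

Lemma avgstate_density : density (avgstate p).
Proof.
split=> [v|].
  have e (rho : 'M[C]_d) : (v^t* *m rho *m v) ord0 ord0 = \tr ((v *m v^t*) *m rho).
    by rewrite -(mulmxA v) [RHS]mxtrace_mulC /mxtrace big_ord1.
  rewrite lecE; apply/andP; split; last first.
    rewrite e; apply: avglin_avg_ge0 (avglin_trmul _) => rho [h _].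
    by rewrite -e; have := h v; rewrite lecE => /andP[].
  (* The order on R[i] also demands a zero imaginary part; up to sign this is the real part of 'i
     times the form, a functional that vanishes on every density matrix. *)
  rewrite e -[X in X == _]opprK -ReiNIm.
  rewrite mulrC -mxtraceZ scalemxAl.
  rewrite (@avglin_avg_const _ 0 _ (avglin_trmul _)) ?oppr0// => rho [h _].
  rewrite -scalemxAl mxtraceZ mulrC ReiNIm -e.
  by have := h v; rewrite lecE => /andP[/eqP -> _]; rewrite oppr0.
apply/eqP; rewrite eq_complex; apply/andP; split; apply/eqP.
  rewrite -[avgstate p]mul1mx (@avglin_avg_const _ 1 _ (avglin_trmul _))// => rho [_ h].
  by rewrite mul1mx h.
rewrite -[LHS]opprK -ReiNIm mulrC -mxtraceZ -[avgstate p]mul1mx scalemxAl.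
rewrite (@avglin_avg_const _ 0 _ (avglin_trmul _)) ?oppr0// => rho [_ h].
by rewrite -scalemxAl mul1mx mxtraceZ h mulr1.
Qed.

Definition upd n (x : {ffun 'I_n -> 'M[C]_d}) k (y : 'M[C]_d) : {ffun 'I_n -> 'M[C]_d} :=
  [ffun j => if j == k then y else x j].

Definition fcons n (y : 'M[C]_d) (x : {ffun 'I_n -> 'M[C]_d}) : {ffun 'I_n.+1 -> 'M[C]_d} :=
  [ffun k => if unlift ord0 k is Some j then x j else y].

Lemma fcons_upd n y (x : {ffun 'I_n -> 'M[C]_d}) k z :
  fcons y (upd x k z) = upd (fcons y x) (lift ord0 k) z.
Proof.
apply/ffunP => j; rewrite !ffunE.
case: unliftP => [i ->|->]; first by rewrite ffunE (inj_eq lift_inj).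
by rewrite eqE/=.
Qed.

Lemma fcons_upd0 n y (x : {ffun 'I_n -> 'M[C]_d}) z :
  fcons y x = upd (fcons z x) ord0 y.
Proof.
apply/ffunP => j; rewrite !ffunE.
by case: unliftP => [i ->|->]; rewrite ?eqE.
Qed.

Lemma fcons_const n y : @fcons n y [ffun=> y] = [ffun=> y].
Proof.
by apply/ffunP => j; rewrite !ffunE; case: unliftP => [i _|//]; rewrite ffunE.
Qed.

Lemma fcons_bij n : set_bij (D `*` @words R d n) (@words R d n.+1)
  (fun z => fcons z.1 z.2).
Proof.
split.
- move=> [y x] [/= Dy Dx] k; rewrite ffunE.
  by case: unliftP => [j _|_] //; exact: Dx.
- move=> [y x] [y' x'] _ _ /= /ffunP h; congr (_, _).
    by have := h ord0; rewrite !ffunE unlift_none.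
  by apply/ffunP => k; have := h (lift ord0 k); rewrite !ffunE liftK.
- move=> x Dx; exists (x ord0, [ffun k => x (lift ord0 k)]).
    by split=> /=; [exact: Dx|move=> k; rewrite ffunE; exact: Dx].
  apply/ffunP => k; rewrite !ffunE/=.
  by case: unliftP => [j ->|->//]; rewrite ffunE.
Qed.

Lemma wordprob_ge0 n (x : {ffun 'I_n -> 'M[C]_d}) : words x -> 0 <= wordprob p x.
Proof. by move=> hx; apply: prodr_ge0 => k _; case: hp => + _; apply. Qed.

(** Induction on n: with the first letter fixed, the induction hypothesis replaces all later letters
    by the average state; then the first letter is averaged. *)
Lemma esum_multilinear n (F : {ffun 'I_n -> 'M[C]_d} -> R) :
  (forall x, words x -> 0 <= F x) ->
  (forall x k, avglin (fun y => F (upd x k y))) ->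
  (\esum_(x in @words R d n) (wordprob p x * F x)%:E = (F [ffun=> avgstate p])%:E)%E.
Proof.
elim: n F => [|n IH] F F0 Flin.
  rewrite (_ : @words R d 0 = [set [ffun=> avgstate p]]); last first.
    apply/seteqP; split=> [x _|x _ []//]; by apply/ffunP => -[].
  rewrite esum_set1 /wordprob big_ord0 ?mul1r// lee_fin; apply: F0 => -[]//.
have hav := avgstate_density.
rewrite (@reindex_esum R _ _ _ _ _ _ (fcons_bij n)).
transitivity (\esum_(y in D) \esum_(x in @words R d n)
    (wordprob p x * (p y * F (fcons y x)))%:E)%E.
  rewrite esum_esum => [|y x Dy Dx]; last first.
    rewrite lee_fin mulr_ge0 ?wordprob_ge0// mulr_ge0//; first by case: hp => + _; apply.
    apply: F0 => k; rewrite ffunE; case: unliftP => [j _|_] //; exact: Dx.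
  apply: eq_esum => -[y x] [Dy Dx]; congr (_%:E).
  rewrite /= {1}/wordprob big_ord_recl ffunE unlift_none mulrCA -mulrA; congr (_ * _).
  congr (_ * _); apply: eq_bigr => k _.
  by rewrite ffunE liftK.
transitivity (\esum_(y in D) (p y * F (fcons y [ffun=> avgstate p]))%:E)%E.
  apply: eq_esum => y Dy.
  rewrite (IH (fun x => p y * F (fcons y x)))// => [x Dx|x k].
    rewrite mulr_ge0//; first by case: hp => + _; apply.
    apply: F0 => k; rewrite ffunE; case: unliftP => [j _|_] //; exact: Dx.
  apply: avglinZ; apply: avglin_eq (Flin (fcons y x) (lift ord0 k)) => z.
  by rewrite fcons_upd.
rewrite (@avglin_ge0 (fun y => F (fcons y [ffun=> avgstate p]))) ?fcons_const//.
  move=> y Dy; apply: F0 => k; rewrite ffunE; case: unliftP => [j _|_] //.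
  by rewrite ffunE.
(* The letter 0 is a placeholder, overwritten by the update at position 0. *)
apply: avglin_eq (Flin (fcons 0 [ffun=> avgstate p]) ord0) => y.
by rewrite -fcons_upd0.
Qed.

Lemma tensor_psd n (x : {ffun 'I_n -> 'M[C]_d}) : words x -> psdmx (tensor x).
Proof.
move=> hx; have -> : tensor x = tpow (fun k => psdsqrt (x k)) *m
    tpow (fun k => psdsqrt (x k)).
  rewrite tpowM; suff -> : (fun k => psdsqrt (x k) *m psdsqrt (x k)) = x by [].
  by apply/funext => k; apply: psdsqrt_sqr; case: (hx k).
have {1}-> : tpow (fun k => psdsqrt (x k)) = (tpow (fun k => psdsqrt (x k)))^t*.
  rewrite tpow_adj; congr tpow; apply/funext => k.
  by rewrite psd_herm//; apply: psdsqrt_psd; case: (hx k).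
exact: psd_gram.
Qed.

Lemma tensor_tr n (x : {ffun 'I_n -> 'M[C]_d}) : words x -> \tr (tensor x) = 1.
Proof.
move=> hx.
transitivity (\prod_(k < n) \tr (x k)).
  rewrite /mxtrace (bigA_distr_bigA (fun k i => x k i i)) -sum_wd.
  by apply: eq_bigr => i _; rewrite mxE.
by rewrite big1// => k _; case: (hx k).
Qed.

Lemma tensor_const n (rho : 'M[C]_d) :
  tensor [ffun=> rho] = tpow (fun _ : 'I_n => rho).
Proof. by apply/matrixP => i j; rewrite !mxE; apply: eq_bigr => k _; rewrite ffunE. Qed.

(** The trace is linear in each letter, since letter k contributes exactly one factor to every entry
    of the tensor product. *)
Lemma average_tensor n (M : 'M[C]_(tdim d n)) : psdmx M ->
  (\esum_(x in @words R d n) (wordprob p x * complex.Re (\tr (M *m tensor x)))%:E =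
   (complex.Re (\tr (M *m tpow (fun _ : 'I_n => avgstate p))))%:E)%E.
Proof.
move=> hM; rewrite (@esum_multilinear n (fun x => complex.Re (\tr (M *m tensor x)))).
- by rewrite tensor_const.
- move=> x hx; apply: (@Re_le _ 0); exact: (psd_trM_ge0 hM (tensor_psd hx)).
move=> x k.
apply: avglin_eq (avglin_sum (index_enum 'I_(tdim d n)) (P := xpredT) (F := fun i y =>
  \sum_j complex.Re ((M i j * \prod_(l < n | l != k) x l (wd j l) (wd i l)) *
     y (wd j k) (wd i k))) _) => [y|i _].
  rewrite /mxtrace raddf_sum; apply: eq_bigr => i _.
  rewrite mxE raddf_sum; apply: eq_bigr => j _; congr complex.Re.
  rewrite mxE [in RHS](bigD1 k)//= ffunE eqxx -mulrA; congr (_ * _).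
  rewrite mulrC; congr (_ * _); apply: eq_bigr => l /negPf lk.
  by rewrite ffunE lk.
by apply: avglin_sum => j _; exact: avglin_mul.
Qed.

End Average.

(** * Semicontinuity of the rate function *)

Section RateFunction.
Variables (R : realType) (d : nat).

Definition xlnx (x : R) : R := x * ln x.

(** With u = sqrt x, this is ln(1/u) <= 1/u. It serves the continuity of x ln x at 0; for negative x
    the logarithm is 0 by convention. *)
Lemma xlnx_bound (x : R) : x < 1 -> `|xlnx x| <= 2 * Num.sqrt x.
Proof.
move=> x1; have [x0|x0] := leP x 0.
  by rewrite /xlnx ln0// mulr0 normr0 mulr_ge0// sqrtr_ge0.
set u := Num.sqrt x.
have u0 : 0 < u by rewrite sqrtr_gt0.
have xu : x = u ^+ 2 by rewrite sqr_sqrtr// ltW.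
have lnx : ln x = - 2 * ln u^-1.
  by rewrite [in LHS]xu lnXn// lnV ?posrE// -[LHS]mulr_natl; ring.
have h : ln u^-1 <= u^-1.
  have := @le_ln1Dx R (u^-1 - 1); rewrite addrCA subrr addr0 => h.
  apply: le_trans (h _) _; first by rewrite ltrBrDr addNr invr_gt0.
  by rewrite lerBlDr lerDl.
have lx0 : ln x <= 0 by rewrite ln_le0// ltW.
rewrite /xlnx normrM (gtr0_norm x0) (ler0_norm lx0) lnx mulNr opprK.
rewrite mulrCA ler_wpM2l// xu expr2 -mulrA ler_piMr// ?(ltW u0)//.
by rewrite mulrC -ler_pdivlMr// mul1r.
Qed.

Lemma continuous_xlnx : continuous xlnx.
Proof.
move=> x; have [x0|x0|->] := ltgtP x 0.
- rewrite /continuous_at; apply: cvg_near_cst.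
  near=> y; rewrite /xlnx !ln0 ?mulr0//; first exact: ltW.
  by apply: ltW; near: y; exact: lt_nbhsl.
- by apply: cvgM; [exact: cvg_id|exact: continuous_ln].
- rewrite /continuous_at {2}/xlnx mul0r.
  apply/norm_cvg0P.
  apply: (@squeeze_cvgr _ _ _ _ (fun=> 0) (fun x => 2 * Num.sqrt x)).
  + near=> y; rewrite normr_ge0/= xlnx_bound//.
    by near: y; exact: lt_nbhsl.
  + exact: cvg_cst.
  + have := @sqrt_continuous R 0; rewrite /continuous_at sqrtr0 => h.
    by rewrite -[X in _ --> X](mulr0 2); apply: cvgMr.
Unshelve. all: by end_near. Qed.

Lemma continuous_sum (T : topologicalType) (I : Type) (r : seq I) (F : I -> T -> R) :
  (forall i, continuous (F i)) -> continuous (fun v => \sum_(i <- r) F i v).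
Proof.
move=> hF; elim: r => [|i r IH] v.
  have -> : (fun v => \sum_(i <- [::]) F i v) = (fun=> 0).
    by apply/funext => w; rewrite big_nil.
  exact: cvg_cst.
have -> : (fun v => \sum_(j <- i :: r) F j v) = F i \+ (fun v => \sum_(j <- r) F j v).
  by apply/funext => w; rewrite big_cons.
by apply: cvgD; [exact: hF|exact: IH].
Qed.

Lemma closed_preimage (T U : topologicalType) (f : T -> U) (A : set U) :
  continuous f -> closed A -> closed [set x | A (f x)].
Proof. by move=> /continuous_closedP; apply. Qed.

Lemma continuous_xlnx_coord i : continuous (fun v : 'rV[R]_d => xlnx (v ord0 i)).
Proof.
move=> v; apply: (@continuous_comp _ _ _ (fun v : 'rV[R]_d => v ord0 i) xlnx).
  exact: coord_continuous.
exact: continuous_xlnx.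
Qed.

(** Turns the sublevel sets of D(.||a) into closed conditions: a support condition and an inequality
    between continuous functions. The default value ln 0 = 0 is harmless there, since b i = 0
    whenever a i = 0. *)
Lemma relentropy_le_real (a b : 'I_d -> R) (M : R) : (forall i, 0 <= a i) -> distr b ->
  (relentropy b a <= M%:E)%E <->
  (forall i, a i = 0 -> b i = 0) /\ \sum_i (xlnx (b i) - b i * ln (a i)) <= M.
Proof.
move=> a0 [b0 _].
have E : (forall i, a i = 0 -> b i = 0) ->
    relentropy b a = (\sum_i (xlnx (b i) - b i * ln (a i)))%:E.
  move=> ba; rewrite -sumEFin; apply: eq_bigr => i _.
  case: eqP => [->|/eqP bi]; first by rewrite /xlnx !mul0r subrr.
  have ai : a i != 0 by apply: contra_neq bi; exact: ba.
  by rewrite (negPf ai) ln_div ?posrE ?lt_def ?bi ?ai ?a0 ?b0// mulrBr.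
split=> [h|[ba h]]; last by rewrite E// lee_fin.
suff ba : forall i, a i = 0 -> b i = 0 by split=> //; rewrite -lee_fin -E.
move=> i ai; apply: contrapT => /eqP bi.
move: h; rewrite /relentropy (bigD1 i)//= (negPf bi) ai eqxx addye ?leye_eq//.
elim/big_ind: _ => //= [x y hx hy|j _].
  by rewrite adde_eq_ninfty negb_or hx.
by case: ifP => // _; case: ifP.
Qed.

(** The set A of distributions with D(b||a) <= M is compact, so the entropy attains its maximum on
    it. That maximum is below r because the infimum exceeds M, and [tau] is half the gap; for empty
    A any [tau] works. *)
Lemma rate_lsc (a : 'I_d -> R) (r M : R) : (forall i, 0 <= a i) ->
  (M%:E < ereal_inf [set relentropy b a
    | b in [set b : 'I_d -> R | distr b /\ (r <= entropy b)%R]])%E ->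
  exists2 tau : R, 0 < tau &
    forall b : 'I_d -> R, distr b -> r - tau <= entropy b -> (M%:E <= relentropy b a)%E.
Proof.
move=> a0 hM.
pose A := [set v : 'rV[R]_d | [/\ forall i, 0 <= v ord0 i, \sum_i v ord0 i = 1,
  forall i, a i = 0 -> v ord0 i = 0 &
  \sum_i (xlnx (v ord0 i) - v ord0 i * ln (a i)) <= M]].
have AP (b : 'I_d -> R) : distr b -> (relentropy b a <= M%:E)%E -> A (\row_i b i).
  move=> hb /(relentropy_le_real _ a0 hb) [h1 h2]; have [h3 h4] := hb.
  split=> [i||i ai|]; [by rewrite mxE| |by rewrite mxE h1|].
    by rewrite -[RHS]h4; apply: eq_bigr => i _; rewrite mxE.
  by apply: le_trans h2; apply: ler_sum => i _; rewrite mxE.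
have AP' v : A v -> distr (v ord0) /\ (relentropy (v ord0) a <= M%:E)%E.
  by move=> [h1 h2 h3 h4]; split=> //; apply/relentropy_le_real.
pose H (v : 'rV[R]_d) := entropy (v ord0).
have cH : continuous H.
  have c : continuous (fun v : 'rV[R]_d => \sum_i xlnx (v ord0 i)).
    by apply: continuous_sum => i; exact: continuous_xlnx_coord.
  by move=> v; exact: cvgN (c v).
have [[v0 Av0]|A0] := pselect (A !=set0); last first.
  exists 1 => // b hb _; rewrite leNgt; apply/negP => /ltW/(AP _ hb) h.
  by apply: A0; exists (\row_i b i).
have cA : compact A.
  apply: bounded_closed_compact.
    exists 1; split=> // x x1 v [h1 h2 _ _]; apply: le_trans (ltW x1).
    rewrite /Num.norm/= mx_normrE; apply: bigmax_le => //= -[i j] _.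
    rewrite ord1/= ger0_norm// -h2 (bigD1 j)//= lerDl.
    exact: sumr_ge0.
  have -> : A = \bigcap_(i in [set: 'I_d]) [set v : 'rV[R]_d | 0 <= v ord0 i] `&`
     [set v | \sum_i v ord0 i = 1] `&`
     \bigcap_(i in [set i : 'I_d | a i = 0]) [set v : 'rV[R]_d | v ord0 i = 0] `&`
     [set v | \sum_i (xlnx (v ord0 i) - v ord0 i * ln (a i)) <= M].
    apply/seteqP; split=> v /= [].
      by move=> h1 h2 h3 h4; split=> //; split; [split=> // i _; exact: h1|].
    move=> [[h1 h2] h3] h4; split; [|exact: h2|exact: h3|exact: h4].
    by move=> i; exact: (h1 i I).
  have cc i : continuous (fun v : 'rV[R]_d => v ord0 i) by exact: coord_continuous.
  do 3 try apply: closedI.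
  - apply: closed_bigI => i _.
    exact: (@closed_preimage _ _ _ [set x : R | 0 <= x] (cc i) (@closed_ge R 0)).
  - apply: (@closed_preimage _ _ (fun v : 'rV[R]_d => \sum_i v ord0 i) [set x : R | x = 1]).
      exact: continuous_sum.
    exact: closed_eq.
  - apply: closed_bigI => i _.
    exact: (@closed_preimage _ _ _ [set x : R | x = 0] (cc i) (@closed_eq R 0)).
  - apply: (@closed_preimage _ _ (fun v : 'rV[R]_d =>
        \sum_i (xlnx (v ord0 i) - v ord0 i * ln (a i))) [set x : R | x <= M]).
      apply: continuous_sum => i v.
      have h1 : (fun v : 'rV[R]_d => v ord0 i * ln (a i)) @ v --> v ord0 i * ln (a i).
        exact: cvgM (cc i v) (cvg_cst (ln (a i))).
      exact: cvgB (@continuous_xlnx_coord i v) h1.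
    exact: closed_le.
have [v /set_mem Av vmax] := EVT_max_rV (ex_intro _ _ Av0) cA (continuous_subspaceT cH).
have [hv hvM] := AP' v Av.
have Hr : H v < r.
  rewrite ltNge; apply/negP => rH.
  have := lt_le_trans hM (ereal_inf_lbound (ex_intro2 _ _ (v ord0) (conj hv rH) erefl)).
  by rewrite ltNge hvM.
exists ((r - H v) / 2); first by rewrite divr_gt0// subr_gt0.
move=> b hb hrb; rewrite leNgt; apply/negP => /ltW/(AP _ hb) /mem_set/vmax.
have -> : H (\row_i b i) = entropy b.
  by congr entropy; apply/funext => i; rewrite mxE.
by apply/negP; rewrite -ltNge; apply: lt_le_trans hrb; lra.
Qed.

End RateFunction.

(** * Compression into a subspace and its inverse *)

Section ProjectiveEncoding.
Variable C : numClosedFieldType.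
Variables (K r : nat) (S : 'M[C]_(r, K)) (i0 : 'I_r).
Hypothesis hS : S *m S^t* = 1%:M.
Let Q := S^t* *m S.

(* X |-> S X S^* + tr((1 - S^* S) X) |i0><i0| *)
Definition enc_kraus (l : option 'I_K) : 'M[C]_(r, K) :=
  if l is Some i then delta_mx i0 i *m (1%:M - Q) else S.

Definition dec_kraus (l : unit) : 'M[C]_(K, r) := S^t*.

Let hQ : is_proj Q.
Proof.
split; first by rewrite /Q mulmx_adj trmxCK.
by rewrite /Q mulmxA -(mulmxA (S^t* )) hS mulmx1.
Qed.

Lemma enc_kraus_sum : \sum_l (enc_kraus l)^t* *m enc_kraus l = 1%:M.
Proof.
rewrite (bigD1 None)//= -/Q (reindex_omap Some id)/=; last first.
  by move=> [].
have [hQ1 hQ2] := projC hQ.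
rewrite (eq_bigr (fun i => (1%:M - Q) *m delta_mx i i *m (1%:M - Q))); last first.
  move=> i _; rewrite mulmx_adj hQ1 -!mulmxA; congr (_ *m _); rewrite !mulmxA.
  congr (_ *m _).
  have -> : (delta_mx i0 i : 'M[C]_(r, K))^t* = delta_mx i i0.
    by rewrite trmx_delta map_delta_mx.
  exact: mul_delta_mx.
rewrite (eq_bigl xpredT) => [|i]; last by rewrite eqxx.
rewrite -mulmx_suml -mulmx_sumr -mx1_sum_delta mulmx1 hQ2.
by rewrite addrC subrK.
Qed.

Lemma dec_kraus_sum : \sum_l (dec_kraus l)^t* *m dec_kraus l = 1%:M.
Proof. by rewrite (bigD1 tt)//= big1 ?addr0 => [|[]//]; rewrite /dec_kraus trmxCK. Qed.

(** As E lies below Q, the factor (1 - Q) E vanishes and only the Kraus operator S survives. *)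
Lemma enc_krausE (E X : 'M[C]_K) : is_proj E -> E *m Q = E ->
  kraus enc_kraus (E *m X *m E) = S *m (E *m X *m E) *m S^t*.
Proof.
move=> [hE1 hE2] EQ; rewrite /kraus (bigD1 None)//= big1 ?addr0// => -[i _|//].
have QE : Q *m E = E.
  by have := congr1 (fun A => A^t*) EQ; rewrite mulmx_adj hE1; case: hQ => ->.
rewrite /enc_kraus -!mulmxA (mulmxA (1%:M - Q)) mulmxBl mul1mx QE subrr.
by rewrite !mul0mx !mulmx0.
Qed.

Lemma dec_kraus_encE (E X : 'M[C]_K) : is_proj E -> E *m Q = E ->
  kraus dec_kraus (S *m (E *m X *m E) *m S^t*) = E *m X *m E.
Proof.
move=> [hE1 hE2] EQ; rewrite /kraus (bigD1 tt)//= big1 ?addr0 => [|[]//]; rewrite /dec_kraus trmxCK.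
have QE : Q *m E = E.
  by have := congr1 (fun A => A^t*) EQ; rewrite mulmx_adj hE1; case: hQ => ->.
rewrite -!mulmxA -/Q (mulmxA (S^t*)) -/Q (mulmxA Q) QE.
by rewrite EQ.
Qed.

Lemma tr_enc (E X : 'M[C]_K) : is_proj E -> E *m Q = E ->
  \tr (S *m (E *m X *m E) *m S^t*) = \tr (E *m X).
Proof.
move=> [hE1 hE2] EQ; rewrite mxtrace_mulC mulmxA -/Q.
have QE : Q *m E = E.
  by have := congr1 (fun A => A^t*) EQ; rewrite mulmx_adj hE1; case: hQ => ->.
by rewrite !mulmxA QE mxtrace_mulC mulmxA hE2.
Qed.

End ProjectiveEncoding.

(** * Codes measuring weighted projectors *)

Section ProjectiveCode.
Variable R : realType.
Local Notation C := R[i].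
Variables (K : nat) (O : finType) (E : O -> 'M[C]_K) (c : O -> R).
Variables (r : O -> nat) (S : forall w, 'M[C]_(r w, K)) (i0 : forall w, 'I_(r w)).
Hypothesis hE : forall w, is_proj (E w).
Hypothesis hc : forall w, 0 <= c w.
Hypothesis hsum : \sum_w (c w)%:C *: E w = 1%:M.
Hypothesis hS : forall w, S w *m (S w)^t* = 1%:M.
Hypothesis hES : forall w, E w *m ((S w)^t* *m S w) = E w.

Lemma proj_povm_psd w : psdmx ((c w)%:C *: E w).
Proof. apply: (@psdZ C); [by rewrite lecR|exact: proj_psd]. Qed.

Definition projcode : vlcode R K :=
  Vlcode proj_povm_psd hsum
    (fun w => kraus_tpcp (enc_kraus_sum (i0 w) (hS w)))
    (fun w => kraus_tpcp (dec_kraus_sum (hS w))).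

(** The square root of c E is sqrt(c) E by [psdsqrt_proj], and [hES] places E inside the subspace
    kept by S, so compression loses nothing. *)
Lemma encoder_projcode (w : O) rho :
  @encoder R K projcode w rho = (c w)%:C *: (S w *m (E w *m rho *m E w) *m (S w)^t*).
Proof.
rewrite /encoder/=.
have -> : sqrtmx ((c w)%:C *: E w) = sqrtC (c w)%:C *: E w.
  by apply: (@psdsqrt_proj C) => //; rewrite lecR.
rewrite -!scalemxAl -scalemxAr scalerA -expr2 sqrtCK.
rewrite linearZ/=; congr (_ *: _).
exact: (enc_krausE (i0 w) (hS w) _ (hE w) (hES w)).
Qed.

Lemma tr_encoder_projcode (w : O) rho :
  \tr (@encoder R K projcode w rho) = (c w)%:C * \tr (E w *m rho).
Proof.
by rewrite encoder_projcode mxtraceZ (tr_enc (hS w) rho (hE w) (hES w)).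
Qed.

Lemma Re_realM (x : R) (z : C) : complex.Re (x%:C * z) = x * complex.Re z.
Proof. by case: z => a b /=; rewrite mul0r subr0. Qed.

(** Normalization cancels the weight c w, so the decoder returns E rho E / tr(E rho) and
    [bures_proj] applies; outcomes of weight or probability 0 contribute 0. *)
Lemma projcode_error_term (w : O) rho s : density rho ->
  s = @encoder R K projcode w rho ->
  complex.Re (\tr s) * bures rho (decoder (v := projcode) w ((\tr s)^-1 *: s)) ^+ 2 <=
  c w * (complex.Re (\tr (E w *m rho)) * (1 - complex.Re (\tr (E w *m rho)))).
Proof.
move=> [hrho trho] ->; rewrite tr_encoder_projcode Re_realM -mulrA.
have [->|cn0] := eqVneq (c w) 0; first by rewrite !mul0r.
rewrite ler_wpM2l//.
have /andP[t0 _] := tr_proj_bounds hrho (hE w) trho.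
have {}t0 : 0 <= complex.Re (\tr (E w *m rho)) by exact: (@Re_le _ 0 _ t0).
have [tz|tnz] := eqVneq (\tr (E w *m rho)) 0.
  by rewrite tz !mul0r.
rewrite ler_wpM2l//.
have -> : decoder (v := projcode) w
    (((c w)%:C * \tr (E w *m rho))^-1 *: @encoder R K projcode w rho) =
    (\tr (E w *m rho))^-1 *: (E w *m rho *m E w).
  rewrite encoder_projcode scalerA invfM mulrAC mulVf ?mul1r; last first.
    by rewrite eq_complex/= negb_and cn0.
  rewrite linearZ/=; congr (_ *: _).
  exact: (dec_kraus_encE (hS w) rho (hE w) (hES w)).
exact: bures_proj.
Qed.

End ProjectiveCode.

Lemma oproj_diff_mulr (C : numClosedFieldType) m m' n (V : 'M[C]_(m, n))
    (V' : 'M[C]_(m', n)) : (V <= V')%MS ->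
  (oproj V' - oproj V) *m ((onb V')^t* *m onb V') = oproj V' - oproj V.
Proof.
move=> h; have e := oproj_subl h; have e' := oproj_subl (submx_refl V').
by rewrite -/(oproj V') mulmxBl e e'.
Qed.

Lemma tr_oproj_diff (C : numClosedFieldType) m m' n (V : 'M[C]_(m, n))
    (V' : 'M[C]_(m', n)) :
  \tr (oproj V' - oproj V) = (\rank V')%:R - (\rank V)%:R.
Proof. by rewrite raddfB/= !tr_oproj. Qed.

(** * Real traces against a fixed matrix *)

Section RealTrace.
Variables (R : realType) (k : nat).
Local Notation C := R[i].
Implicit Types A X : 'M[C]_k.

Definition rtr X A : R := complex.Re (\tr (A *m X)).

Lemma rtrD X A B : rtr X (A + B) = rtr X A + rtr X B.
Proof. by rewrite /rtr mulmxDl !raddfD. Qed.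

Lemma rtrB X A B : rtr X (A - B) = rtr X A - rtr X B.
Proof. by rewrite /rtr mulmxBl !raddfB. Qed.

Lemma rtrZ X (c : R) A : rtr X (c%:C *: A) = c * rtr X A.
Proof. by rewrite /rtr -scalemxAl mxtraceZ Re_realM. Qed.

Lemma rtr_sum X (I : Type) (r : seq I) (P : pred I) (F : I -> 'M[C]_k) :
  rtr X (\sum_(i <- r | P i) F i) = \sum_(i <- r | P i) rtr X (F i).
Proof.
elim: r => [|i r IH]; first by rewrite !big_nil /rtr mul0mx raddf0.
by rewrite !big_cons; case: ifP => // _; rewrite rtrD IH.
Qed.

Lemma rtr_ge0 X A : psdmx X -> psdmx A -> 0 <= rtr X A.
Proof. by move=> hX hA; apply: (@Re_le _ 0); exact: (@psd_trM_ge0 C _ _ _ hA hX). Qed.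

Lemma rtr1 X : \tr X = 1 -> rtr X 1%:M = 1.
Proof. by rewrite /rtr mul1mx => ->. Qed.

End RealTrace.

(** * Spectral bounds for tensor powers of a state *)

Section StateWords.
Variables (R : realType) (d n : nat).
Local Notation C := R[i].
Local Notation W := {ffun 'I_n -> 'I_d}.
Local Notation K := (tdim d n).
Variables (rho : 'M[C]_d) (hrho : density rho).
Let a := eigenvalues rho.
Let T := tpow (fun _ : 'I_n => rho).

Lemma spectral_eigenvalues i : spectral_diag rho ord0 i = (a i)%:C.
Proof.
have [h _] := hrho; have := @spectral_diag_ge0 C d rho i h.
by move=> /ger0_real/RRe_real.
Qed.

Lemma eigenvalues_distr : distr a.
Proof.
have [h trho] := hrho; split=> [i|].
  have := @spectral_diag_ge0 C d rho i h; rewrite spectral_eigenvalues.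
  by rewrite lecR.
have : \sum_i (a i)%:C = 1.
  rewrite -trho [in RHS](@psd_spectral C d rho h) mxtrace_mulC mulmxA.
  rewrite (unitary_mulmxV (spectral_unitarymx rho)) mul1mx mxtrace_diag.
  by apply: eq_bigr => i _; rewrite spectral_eigenvalues.
rewrite -(raddf_sum (real_complex R)) => /(congr1 (@complex.Re R)).
by [].
Qed.

Definition rqdiag (M : 'M[C]_K) (x : W) : R := complex.Re (qdiag rho M x).

Lemma Re_tr_tpow (M : 'M[C]_K) :
  complex.Re (\tr (M *m T)) = \sum_x pword a x * rqdiag M x.
Proof.
have [h _] := hrho.
rewrite mxtrace_mulC (tr_tpow_mul h) raddf_sum; apply: eq_bigr => x _.
rewrite (eq_bigr (fun k => (a (x k))%:C)); last by move=> k _; exact: spectral_eigenvalues.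
by rewrite -(rmorph_prod (real_complex R)); exact: Re_realM.
Qed.

Lemma rqdiag_ge0 M x : psd M -> 0 <= rqdiag M x.
Proof. by move=> hM; apply: (@Re_le _ 0); exact: qdiag_ge0. Qed.

Lemma rqdiagB M N x : rqdiag (M - N) x = rqdiag M x - rqdiag N x.
Proof. by rewrite /rqdiag qdiagB raddfB. Qed.

Lemma rqdiag1 x : rqdiag 1%:M x = 1.
Proof. by rewrite /rqdiag qdiag1. Qed.

Lemma sum_rqdiag M : \sum_x rqdiag M x = complex.Re (\tr M).
Proof. by rewrite -(@sum_qdiag C d n rho) raddf_sum. Qed.

Lemma rqdiag_bounds M x : psd M -> psd (1%:M - M) -> 0 <= rqdiag M x <= 1.
Proof.
move=> h1 h2; rewrite rqdiag_ge0//= -subr_ge0 -{1}(rqdiag1 x) -rqdiagB.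
exact: rqdiag_ge0.
Qed.

Definition low (t : R) : pred W := fun x => tentropy R x <= t.
Definition Qt (t : R) : 'M[C]_K := oproj (symspan C (low t)).

Lemma low_sub (t u : R) : t <= u -> (symspan C (low t) <= symspan C (low u))%MS.
Proof. by move=> tu; apply: symspan_sub => x; rewrite !unfold_in => /le_trans; exact. Qed.

Lemma rank_low (t : R) : (0 < n)%N ->
  (\rank (symspan C (low t)))%:R <= n.+1%:R ^+ (d * d + d) * expR (n%:R * t).
Proof.
move=> n0; have := @rank_symspan C d n (low t); rewrite -(ler_nat R) => /le_trans.
apply; rewrite natrM natrX exprD -mulrA ler_wpM2l ?exprn_ge0//.
exact: card_low_types.
Qed.

(** On eigenvectors labelled by words of type entropy at most t the diagonal of 1 - Q_t vanishes;
    elsewhere it is at most 1. *)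
Lemma tail_upper (t : R) :
  complex.Re (\tr ((1%:M - Qt t) *m T)) <= \sum_(x : W | t < tentropy R x) pword a x.
Proof.
have [a0 _] := eigenvalues_distr.
rewrite Re_tr_tpow [leRHS]big_mkcond/=; apply: ler_sum => x _.
have /andP[q0 q1] : 0 <= rqdiag (1%:M - Qt t) x <= 1.
  apply: rqdiag_bounds; first exact/proj_psd/projC/oproj_proj.
  by rewrite opprB addrCA subrr addr0; exact/proj_psd/oproj_proj.
case: ifPn => [_|]; first by rewrite ler_piMr// pword_ge0.
rewrite -leNgt => hx.
by rewrite rqdiagB rqdiag1 /rqdiag qdiag_oproj// subrr mulr0.
Qed.

(** The trace of Q_t is poly(n) e^(nt), so for t below the entropy of the state Q_t captures few
    typical words. *)
Lemma typical_low (t s : R) : (0 < n)%N -> 0 < s ->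
  complex.Re (\tr (Qt t *m T)) <= n%:R * infovar a / s ^+ 2 +
    expR (s - n%:R * entropy a) * (n.+1%:R ^+ (d * d + d) * expR (n%:R * t)).
Proof.
move=> n0 s0; rewrite Re_tr_tpow.
apply: le_trans (typical_mass_le eigenvalues_distr s0 _) _.
  move=> x; apply: rqdiag_bounds; first exact/proj_psd/oproj_proj.
  exact/proj_psd/projC/oproj_proj.
rewrite lerD2l ler_wpM2l ?expR_ge0// sum_rqdiag tr_oproj.
apply: le_trans (rank_low t n0).
by rewrite -(rmorph_nat (real_complex R)).
Qed.

(** If M has small trace, 1 - M keeps most of the mass of the words drawn from b;
    [change_of_measure] carries this over to the spectrum of rho. *)
Lemma converse (M : 'M[C]_K) (b : 'I_d -> R) (s : R) :
  psd M -> psd (1%:M - M) -> distr b -> (forall i, b i != 0 -> a i != 0) -> 0 < s ->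
  expR (- (n%:R * realent b a) - s) *
    (1 - n%:R * infovar b / s ^+ 2
       - expR (s - n%:R * entropy b) * complex.Re (\tr M)
       - n%:R * llrvar b a / s ^+ 2)
  <= complex.Re (\tr ((1%:M - M) *m T)).
Proof.
move=> hM hM1 hb ba s0; have [a0 _] := eigenvalues_distr.
have hM2 : psd (1%:M - (1%:M - M)) by rewrite opprB addrCA subrr addr0.
rewrite Re_tr_tpow.
have hq x := rqdiag_bounds x hM hM1; have hq' x := rqdiag_bounds x hM1 hM2.
apply: le_trans (change_of_measure hb a0 ba s0 hq').
rewrite ler_wpM2l ?expR_ge0// lerD2r.
have -> : \sum_x pword b x * rqdiag (1%:M - M) x =
    1 - \sum_x pword b x * rqdiag M x.
  rewrite (eq_bigr (fun x => pword b x - pword b x * rqdiag M x)).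
    by rewrite sumrB sum_pword; case: hb => _ ->; rewrite expr1n.
  by move=> x _; rewrite rqdiagB rqdiag1 mulrBr mulr1.
rewrite -addrA -opprD lerD2l lerN2 -sum_rqdiag.
exact: typical_mass_le.
Qed.

End StateWords.

(** Since g is f delayed by m places, the sum telescopes to the last m values of f. *)
Lemma sum_shifted_diff (V : zmodType) (f g : nat -> V) (m L : nat) (u : V) :
  (forall k, (k < m)%N -> g k = 0) -> (forall k, (k < L)%N -> g (m + k)%N = f k) ->
  (forall k, (k < m)%N -> f (L + k)%N = u) ->
  \sum_(k < m + L) (f k - g k) = u *+ m.
Proof.
move=> g0 gf fu; rewrite sumrB.
have -> : \sum_(k < m + L) f k = \sum_(k < L) f k + u *+ m.
  rewrite addnC big_split_ord/=; congr (_ + _).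
  rewrite (eq_bigr (fun=> u)); first by rewrite sumr_const card_ord.
  by move=> k _; exact: fu.
rewrite big_split_ord/= [X in _ - (X + _)]big1 => [|k _]; last exact: g0.
rewrite add0r [X in _ - X](eq_bigr (fun k : 'I_L => f k)) => [|k _]; last by apply: gf.
by rewrite addrAC subrr add0r.
Qed.

(** * The code with overlapping entropy windows *)

Section SymmetricCode.
Variables (R : realType) (d n m L D : nat) (eta : R).
Local Notation C := R[i].
Local Notation K := (tdim d n).
Hypotheses (d0 : (0 < d)%N) (m0 : (0 < m)%N) (eta0 : 0 < eta).
Hypothesis hL : ln d%:R <= L%:R * eta.
Local Notation O := ('I_(m + L) * 'I_D.+1)%type.
Local Notation Qt := (@Qt R d n).
Local Notation low := (@low R d n).

Definition lev (k : nat) : R := k%:R * eta.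
Definition symE (k : nat) : 'M[C]_K := Qt (lev k) - Qt (lev k - m%:R * eta).
(** The windows of m steps overlap and sum to m times the identity, hence the weight 1/m. Outcomes
    with nonzero second component are the padding. *)
Definition symc (w : O) : R := if w.2 == ord0 then m%:R^-1 else 0.
Definition symdim (k : nat) : nat := \rank (symspan C (low (lev k))).

(** A constant word has probability 1 under its own type, so [pword_etype] forces the entropy to
    vanish. *)
Lemma tentropy_const (i : 'I_d) : tentropy R ([ffun=> i] : {ffun 'I_n -> 'I_d}) = 0.
Proof.
have [n0|n0] := posnP n.
  apply/eqP; rewrite eq_le tentropy_ge0 andbT /tentropy /entropy big1 ?oppr0// => j _.
  by rewrite /etype (_ : n%:R^-1 = 0 :> R) ?mulr0 ?mul0r// [X in X%:R]n0 invr0.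
have := pword_etype R [ffun=> i] n0.
rewrite /pword big1 => [|k _].
  rewrite -{1}expR0 => /expR_inj/esym/eqP; rewrite oppr_eq0 mulf_eq0 pnatr_eq0.
  by rewrite -[n == 0%N]negbK -lt0n n0/= => /eqP.
rewrite /etype (_ : #|_| = n) ?divff ?pnatr_eq0 -?lt0n//.
rewrite -[RHS]card_ord; apply: eq_card => j; rewrite inE !ffunE eqxx.
by rewrite inE.
Qed.

Lemma symdim_gt0 k : (0 < symdim k)%N.
Proof.
apply: (@rank_symspan_gt0 _ _ _ _ [ffun=> Ordinal d0]).
by rewrite /low tentropy_const mulr_ge0// ltW.
Qed.

Lemma lev_sub_le k : (symspan C (low (lev k - m%:R * eta)) <= symspan C (low (lev k)))%MS.
Proof. by apply: low_sub; rewrite gerBl mulr_ge0// ltW. Qed.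

Lemma symE_proj k : is_proj (symE k).
Proof. exact: oproj_diff (lev_sub_le k). Qed.

(** For k < m the lower edge is a negative entropy, where Q is 0; from level L on Q is the identity,
    because L eta >= ln d. *)
Lemma symE_sum : \sum_(k < m + L) symE k = 1%:M *+ m.
Proof.
apply: (@sum_shifted_diff _ (fun k => Qt (lev k))
  (fun k => Qt (lev k - m%:R * eta))) => k hk.
- apply: symspan0 => x; rewrite -ltNge /lev -mulrBl.
  apply: lt_le_trans (tentropy_ge0 R x); rewrite pmulr_llt0//.
  by rewrite subr_lt0 ltr_nat.
- by congr Qt; rewrite /lev natrD mulrDl addrAC subrr add0r.
apply: oproj_symspanT => x; rewrite /low /lev natrD mulrDl.
apply: le_trans (tentropy_le_ln R x d0) _; apply: le_trans hL _.
by rewrite lerDl mulr_ge0// ltW.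
Qed.

Lemma symc_ge0 w : 0 <= symc w.
Proof. by rewrite /symc; case: ifP => // _; rewrite invr_ge0. Qed.

Lemma sum_symc (V : lmodType C) (F : nat -> V) :
  \sum_(w : O) (symc w)%:C *: F w.1 = (m%:R^-1)%:C *: \sum_(k < m + L) F k.
Proof.
rewrite scaler_sumr -(pair_bigA _ (fun (k : 'I_(m + L)) (j : 'I_D.+1) =>
  (symc (k, j))%:C *: F k))/=.
apply: eq_bigr => k _; rewrite (bigD1 ord0)//= big1 ?addr0 /symc/= ?eqxx//.
by move=> j /negPf jn; rewrite jn scale0r.
Qed.

Lemma sym_povm_sum : \sum_(w : O) (symc w)%:C *: symE w.1 = 1%:M.
Proof.
rewrite (sum_symc symE) symE_sum -scalerMnr scalerMnl -(raddfMn (real_complex R)).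
rewrite -[_ *+ m]mulr_natr mulVf ?pnatr_eq0 -?lt0n// -[RHS]scale1r; congr (_ *: _).
Qed.

Lemma symE_onb k : symE k *m ((onb (symspan C (low (lev k))))^t* *m
  onb (symspan C (low (lev k)))) = symE k.
Proof. exact: oproj_diff_mulr (lev_sub_le k). Qed.

Definition symcode : vlcode R K :=
  @projcode R K O (fun w => symE w.1) symc (fun w => symdim w.1)
    (fun w => onb (symspan C (low (lev w.1)))) (fun w => Ordinal (symdim_gt0 w.1))
    (fun w => symE_proj w.1) symc_ge0 sym_povm_sum
    (fun w => onb_mul_adj (symspan C (low (lev w.1)))).

Lemma sum_symcR (F : nat -> R) :
  \sum_(w : O) symc w * F w.1 = m%:R^-1 * \sum_(k < m + L) F k.
Proof.
rewrite mulr_sumr -(pair_bigA _ (fun (k : 'I_(m + L)) (j : 'I_D.+1) =>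
  symc (k, j) * F k))/=.
apply: eq_bigr => k _; rewrite (bigD1 ord0)//= big1 ?addr0 /symc/= ?eqxx//.
by move=> j /negPf jn; rewrite jn mul0r.
Qed.

Definition srate (k : nat) : R :=
  n%:R^-1 * (ln ((m + L) * D.+1)%:R + ln (symdim k)%:R).

(** * Outcome law and average error for a given source *)

Section Source.
Variables (p : 'M[C]_d -> R) (hp : source p).
Let rho := avgstate p.
Let a := eigenvalues rho.
Let T := tpow (fun _ : 'I_n => rho).
Let hrho : density rho := avgstate_density hp.

Lemma T_psd : psdmx T.
Proof.
rewrite /T -tensor_const; apply: tensor_psd => k.
by rewrite ffunE; exact: hrho.
Qed.

Lemma T_tr : \tr T = 1.
Proof.
rewrite /T -tensor_const; apply: tensor_tr => k.
by rewrite ffunE; exact: hrho.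
Qed.

Lemma symcode_outprob (w : O) :
  outprob p (c := symcode) w = (symc w * rtr T (symE w.1))%:E.
Proof.
rewrite /outprob -rtrZ -(average_tensor hp (proj_povm_psd
  (fun w : O => symE_proj w.1) symc_ge0 w)).
apply: eq_esum => x _; congr ((_ * _)%:E).
rewrite tr_encoder_projcode; last by move=> v; exact: symE_onb.
by rewrite -scalemxAl mxtraceZ.
Qed.

Definition symprob (r : R) : R :=
  \sum_(w : O | r <= srate w.1) symc w * rtr T (symE w.1).

Lemma symcode_outprob_ge (r : R) : outprob_ge p symcode r = (symprob r)%:E.
Proof.
rewrite /outprob_ge /symprob -sumEFin; apply: eq_big => [w|w _].
  by rewrite /codelength /srate /= card_prod !card_ord.
exact: symcode_outprob.
Qed.

Lemma symE_tail k : rtr T (symE k) <=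
  \sum_(x : {ffun 'I_n -> 'I_d} | lev k - m%:R * eta < tentropy R x) pword a x.
Proof.
apply: le_trans (tail_upper n hrho _); rewrite -/(rtr T _) -subr_ge0 -rtrB.
apply: rtr_ge0; first exact: T_psd.
rewrite /symE opprB addrA subrK.
exact/proj_psd/projC/oproj_proj.
Qed.

(** Every outcome of rate at least r has the lower edge of its window at t or above, so [symE_tail]
    bounds it by the tail at t; the total weight is (m + L) / m <= m + L. *)
Lemma symprob_upper (r t : R) :
  (forall k, r <= srate k -> t <= lev k - m%:R * eta) ->
  symprob r <= (m + L)%:R *
    \sum_(x : {ffun 'I_n -> 'I_d} | t < tentropy R x) pword a x.
Proof.
move=> ht; have [a0 _] := eigenvalues_distr hrho.
set U := \sum_(x | _) _.
have U0 : 0 <= U by apply: sumr_ge0 => x _; exact: pword_ge0.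
apply: (@le_trans _ _ (\sum_(w : O) symc w * U)).
  rewrite /symprob big_mkcond; apply: ler_sum => w _.
  case: ifPn => [/ht h|_]; last by rewrite mulr_ge0// symc_ge0.
  rewrite ler_wpM2l ?symc_ge0//; apply: le_trans (symE_tail _) _.
  rewrite big_mkcond [leRHS]big_mkcond/=; apply: ler_sum => x _.
  case: ifPn => [/(le_lt_trans h) ->//|_].
  by case: ifP => // _; exact: pword_ge0.
rewrite (sum_symcR (fun=> U)) sumr_const card_ord -[U *+ _]mulr_natl.
by rewrite ler_piMl ?mulr_ge0// invf_le1 ?ltr0n// ler1n.
Qed.

Lemma tr_symE k : complex.Re (\tr (symE k)) <= (symdim k)%:R.
Proof.
have -> : \tr (symE k) =
    (symdim k)%:R - (\rank (symspan C (low (lev k - m%:R * eta))))%:R.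
  exact: tr_oproj_diff.
rewrite -!(rmorph_nat (real_complex R)) -rmorphB.
by apply: (@le_trans _ _ ((symdim k)%:R - (\rank (symspan C (low (lev k - m%:R * eta))))%:R));
  [exact: lexx|rewrite gerBl].
Qed.

(** Apply [converse] to the sum M of the POVM elements of rate below r. Such a rate bounds the
    dimension by e^(nr) / N, with N the size of the data set, so the trace of M is at most e^(nr) /
    (D + 1): the padding makes it small. *)
Lemma symprob_lower (b : 'I_d -> R) (r s : R) : (0 < n)%N ->
  distr b -> (forall i, b i != 0 -> a i != 0) -> 0 < s ->
  expR (- (n%:R * realent b a) - s) *
    (1 - n%:R * infovar b / s ^+ 2
       - expR (s - n%:R * entropy b) * (expR (n%:R * r) / D.+1%:R)
       - n%:R * llrvar b a / s ^+ 2)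
  <= symprob r.
Proof.
move=> n0 hb ba s0.
pose M : 'M[C]_K := \sum_(w : O | ~~ (r <= srate w.1)) (symc w)%:C *: symE w.1.
have hw (w : O) : psdmx ((symc w)%:C *: symE w.1).
  exact: (proj_povm_psd (fun w : O => symE_proj w.1) symc_ge0 w).
have hM : psdmx M by apply: (@psd_sum C) => w _; exact: hw.
have M1 : 1%:M - M = \sum_(w : O | r <= srate w.1) (symc w)%:C *: symE w.1.
  rewrite -sym_povm_sum (bigID (fun w : O => r <= srate w.1))/= -/M.
  by rewrite addrK.
have hM1 : psdmx (1%:M - M) by rewrite M1; apply: (@psd_sum C) => w _; exact: hw.
have -> : symprob r = complex.Re (\tr ((1%:M - M) *m T)).
  by rewrite -/(rtr T _) M1 rtr_sum; apply: eq_bigr => w _; rewrite rtrZ.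
apply: le_trans (converse hrho hM hM1 hb ba s0).
rewrite ler_wpM2l ?expR_ge0// lerD2r lerD2l lerN2 ler_wpM2l ?expR_ge0//.
have -> : complex.Re (\tr M) =
    \sum_(w : O | ~~ (r <= srate w.1)) symc w * complex.Re (\tr (symE w.1)).
  have R1 (A : 'M[C]_K) : complex.Re (\tr A) = rtr 1%:M A by rewrite /rtr mulmx1.
  rewrite R1 rtr_sum; apply: eq_bigr => w _.
  by rewrite rtrZ R1.
set N : R := ((m + L) * D.+1)%:R.
have N0 : 0 < N by rewrite ltr0n muln_gt0 addn_gt0 m0.
apply: (@le_trans _ _ (\sum_(w : O) symc w * (expR (n%:R * r) / N))).
  rewrite big_mkcond; apply: ler_sum => w _.
  case: ifPn => [|_]; last by rewrite mulr_ge0 ?symc_ge0// divr_ge0 ?expR_ge0// ltW.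
  rewrite -ltNge => hr; rewrite ler_wpM2l ?symc_ge0//.
  apply: le_trans (tr_symE _) _; rewrite ler_pdivlMr// mulrC.
  have sd : 0 < (symdim w.1)%:R :> R by rewrite ltr0n symdim_gt0.
  rewrite -[leLHS]lnK ?posrE ?mulr_gt0// ler_expR lnM ?posrE//.
  by rewrite -ler_pdivrMl ?ltr0n//; exact: ltW.
rewrite (sum_symcR (fun=> _)) sumr_const card_ord -[_ *+ (m + L)]mulr_natl.
have mL : 0 < (m + L)%:R :> R by rewrite ltr0n addn_gt0 m0.
have -> : (m + L)%:R * (expR (n%:R * r) / N) = expR (n%:R * r) / D.+1%:R.
  by rewrite /N natrM invfM mulrCA [_ * (_^-1 * _)]mulrA divff ?gt_eqF// mul1r.
by rewrite ler_piMl ?divr_ge0 ?expR_ge0// invf_le1 ?ltr0n// ler1n.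
Qed.

(** G holds the good levels, whose windows are gentle on the average. The error of each word is
    bounded by an expression affine in the state, so its average over words can be evaluated at the
    average state. *)
Lemma symcode_avgerror (G : pred 'I_(m + L)) (dl : R) : (#|G| <= m)%N ->
  (forall k : 'I_(m + L), G k -> 1 - rtr T (symE k) <= dl) ->
  (avgerror p symcode <= (m%:R^-1 * (2 * dl *+ #|G| + (m%:R - #|G|%:R)))%:E)%E.
Proof.
move=> Gm hG.
(* The observable whose expectation is the affine bound; |G| <= m makes it positive, as
   [average_tensor] requires. *)
pose M : 'M[C]_K := (m%:R^-1)%:C *: (\sum_(k | G k) 2%:C *: (1%:M - symE k)
  + (m%:R - #|G|%:R)%:C *: 1%:M).
have hM : psdmx M.
  apply: (@psdZ C); first by rewrite lecR invr_ge0.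
  apply: (@psdD C); last first.
    apply: (@psdZ C); first by rewrite lecR subr_ge0 ler_nat.
    by have := @psd_gram C K K 1%:M; rewrite adj1 mulmx1.
  apply: (@psd_sum C) => k _; apply: (@psdZ C); first by rewrite lecR.
  exact/proj_psd/projC/symE_proj.
have rM X : \tr X = 1 -> rtr X M =
    m%:R^-1 * (2 * \sum_(k | G k) (1 - rtr X (symE k)) + (m%:R - #|G|%:R)).
  move=> X1; rewrite /M rtrZ rtrD rtrZ rtr1// mulr1 rtr_sum mulr_sumr.
  congr (_ * (_ + _)); apply: eq_bigr => k _.
  by rewrite rtrZ rtrB rtr1.
apply: (@le_trans _ _ (rtr T M)%:E); last first.
  rewrite lee_fin rM ?T_tr// ler_wpM2l ?invr_ge0// lerD2r.
  rewrite -mulrnAr ler_wpM2l// -sumr_const.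
  by rewrite [leRHS](eq_bigl G)//; apply: ler_sum => k Gk; exact: hG.
rewrite -(average_tensor hp hM); apply: le_esum => x hx.
rewrite lee_fin ler_wpM2l ?wordprob_ge0//.
have X1 := tensor_tr hx; have Xp := tensor_psd hx.
set X := tensor x in X1 Xp *; rewrite -/(rtr X M) rM//.
pose t k := rtr X (symE k).
have ht k : 0 <= t k <= 1.
  apply/andP; split; first exact: (rtr_ge0 Xp (proj_psd (symE_proj k))).
  rewrite -subr_ge0 -(rtr1 X1) -rtrB.
  exact: (rtr_ge0 Xp (proj_psd (projC (symE_proj k)))).
have st : \sum_(k < m + L) t k = m%:R.
  rewrite /t -rtr_sum symE_sum -scaler_nat -(rmorph_nat (real_complex R)).
  by rewrite rtrZ rtr1// mulr1.
apply: (@le_trans _ _ (\sum_(w : O) symc w * (t w.1 * (1 - t w.1)))).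
  rewrite /worderror; apply: ler_sum => w _.
  apply: (projcode_error_term (S := fun w : O => onb (symspan C (low (lev w.1))))) => //.
  by move=> v; exact: symE_onb.
rewrite (sum_symcR (fun k => t k * (1 - t k))) ler_wpM2l ?invr_ge0//.
(* Bound t (1 - t) by 1 - t on good levels, written so as to exhibit a summand t, and by t
   elsewhere. The summands t then add up to m. *)
apply: (@le_trans _ _ (\sum_(k < m + L) (if G k then 2 * (1 - t k) - 1 + t k else t k))).
  apply: ler_sum => k _; have /andP[t0 t1] := ht k; case: ifP => _; nra.
apply: (@le_trans _ _ (\sum_(k < m + L) (t k + if G k then 2 * (1 - t k) - 1 else 0))).
  by apply: ler_sum => k _; case: ifP => _; lra.
rewrite big_split/= st -big_mkcond/= sumrB -mulr_sumr sumr_const.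
rewrite (_ : #|[pred k | G k]| = #|G|)//; lra.
Qed.

End Source.
End SymmetricCode.

(** * Extended real limits and the scale of the parameters *)

Lemma cvge_by_bounds (R : realType) (u : nat -> \bar R) (l : \bar R) :
  (forall M : R, (M%:E < l)%E -> \forall n \near \oo, (M%:E <= u n)%E) ->
  (forall M : R, (l < M%:E)%E -> \forall n \near \oo, (u n <= M%:E)%E) ->
  u @ \oo --> l.
Proof.
case: l => [l| |] lo up.
- apply/fine_cvgP; split.
    have h1 := lo (l - 1); have h2 := up (l + 1).
    rewrite lte_fin ltrBlDr ltrDl in h1; rewrite lte_fin ltrDl in h2.
    have {}h1 := h1 ltr01; have {}h2 := h2 ltr01.
    near=> n; rewrite fin_numElt; apply/andP; split.
      apply: (@lt_le_trans _ _ (l - 1)%:E); first exact: ltNyr.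
      by near: n; exact: h1.
    apply: (@le_lt_trans _ _ (l + 1)%:E); last exact: ltry.
    by near: n; exact: h2.
  apply/cvgrPdist_le => e e0.
  have h1 : \forall n \near \oo, ((l - e)%:E <= u n)%E.
    by apply: lo; rewrite lte_fin ltrBlDr ltrDl.
  have h2 : \forall n \near \oo, (u n <= (l + e)%:E)%E.
    by apply: up; rewrite lte_fin ltrDl.
  near=> n; rewrite /=.
  have : ((l - e)%:E <= u n)%E by near: n.
  have : (u n <= (l + e)%:E)%E by near: n.
  case: (u n) => [x| |]//=; rewrite !lee_fin => a1 a2.
  by rewrite ler_norml; apply/andP; split; lra.
- by apply/cvgeyPge => A; apply: lo; exact: ltry.
- by apply/cvgeNyPle => A; apply: up; exact: ltNyr.
Unshelve. all: by end_near. Qed.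

Lemma lte_real_dense (R : realType) (M : R) (l : \bar R) : (M%:E < l)%E ->
  exists2 M' : R, M < M' & (M'%:E < l)%E.
Proof.
case: l => [l| |]//; last by exists (M + 1); [rewrite ltrDl|exact: ltry].
by rewrite lte_fin => Ml; exists ((M + l) / 2); rewrite ?lte_fin; lra.
Qed.

(* root8 n is the integer part of n^(1/8), except that root8 0 = 1. *)
Definition root8 (n : nat) : nat := maxn 1 (\max_(k < n.+1 | (k ^ 8 <= n)%N) k).

Lemma root8_gt0 n : (0 < root8 n)%N. Proof. by rewrite leq_max. Qed.

Lemma root8_ge n k : (k ^ 8 <= n)%N -> (k <= root8 n)%N.
Proof.
move=> hk; have kn : (k < n.+1)%N.
  rewrite ltnS (leq_trans _ hk)//; case: k {hk} => // k.
  by rewrite -{1}(expn1 k.+1) leq_pexp2l.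
by rewrite leq_max (@leq_bigmax_cond _ (fun k : 'I_n.+1 => k ^ 8 <= n)%N val (Ordinal kn)) ?orbT.
Qed.

Lemma root8_le n : (0 < n)%N -> (root8 n ^ 8 <= n)%N.
Proof.
move=> n0; rewrite /root8.
have h : ((\max_(k < n.+1 | (k ^ 8 <= n)%N) k) ^ 8 <= n)%N.
  by elim/big_ind: _ => // x y hx hy; rewrite /maxn; case: ifP.
by rewrite /maxn; case: ifP => // _; rewrite exp1n.
Qed.

Lemma root8_lt n : (n < (root8 n).+1 ^ 8)%N.
Proof. by rewrite ltnNge; apply/negP => /root8_ge; rewrite ltnn. Qed.

(** Error terms are brought to the form c / [root8 n], so this is the one limit used; the threshold
    is k^8 for an integer k > |c| / e. *)
Lemma near_root8 (R : realType) (c e : R) : 0 < e ->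
  \forall n \near \oo, (0 < n)%N /\ c / (root8 n)%:R <= e.
Proof.
move=> e0; pose k := (Num.truncn (`|c| / e)).+1.
exists (k ^ 8)%N => // n /= hn; split; first by rewrite (leq_trans _ hn)// expn_gt0.
rewrite ler_pdivrMr ?ltr0n ?root8_gt0// mulrC -ler_pdivrMr//.
apply: le_trans (_ : k%:R <= _); last by rewrite ler_nat root8_ge.
have := Num.Theory.truncnS_gt (`|c| / e); rewrite -/k => /ltW; apply: le_trans.
by rewrite ler_pM2r ?invr_gt0// ler_norm.
Qed.

Lemma expRN_le_inv (R : realType) (y : R) : 0 < y -> expR (- y) <= y^-1.
Proof.
move=> y0; rewrite expRN lef_pV2 ?posrE ?expR_gt0//.
by apply: le_trans (expR_ge1Dx y); rewrite lerDr.
Qed.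

Lemma ln_le_self (R : realType) (x : R) : 0 < x -> ln x <= x.
Proof.
move=> x0; have := @le_ln1Dx R (x - 1); rewrite addrCA subrr addr0 => h.
by apply: le_trans (h _) _; [rewrite ltrBrDr addNr|rewrite gerBl].
Qed.

(** * The parameters as functions of n *)

Section Asymptotics.
Variables (R : realType) (d : nat).
Hypothesis d0 : (0 < d)%N.
Local Notation C := R[i].

Section Grid.
Variable n : nat.
Let N := root8 n.
Let Nr : R := N%:R.

(** With N = [root8 n], a window of N steps has width 1/N, which tends to 0. Yet n times the step is
    at least N^6, which dominates both the logarithms of polynomial factors, of order N, and the
    fluctuations, of order sqrt n. *)
Definition step : R := ((root8 n)%:R ^+ 2)^-1.
Definition pad : nat := Num.truncn (expR (n%:R * step)).
Definition nlev : nat := (root8 n + d * root8 n ^ 2)%N.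

Lemma Nr_ge1 : 1 <= Nr. Proof. by rewrite ler1n root8_gt0. Qed.

Lemma step_gt0 : 0 < step.
Proof. by rewrite invr_gt0 exprn_gt0// ltr0n root8_gt0. Qed.

(** The grid reaches up to d, and ln d <= d. *)
Lemma step_cover : ln d%:R <= (d * root8 n ^ 2)%:R * step.
Proof.
rewrite natrM natrX /step mulfK; first by rewrite ln_le_self// ltr0n.
by rewrite expf_neq0// pnatr_eq0 -lt0n root8_gt0.
Qed.

Definition univcode : vlcode R (tdim d n) :=
  @symcode R d n (root8 n) (d * root8 n ^ 2) pad step
    d0 (root8_gt0 n) step_gt0 step_cover.

Hypothesis n0 : (0 < n)%N.

Lemma n_ge : Nr ^+ 8 <= n%:R.
Proof. by rewrite /Nr -natrX ler_nat root8_le. Qed.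

Lemma div_n (c : R) : 0 <= c -> c / n%:R <= c / Nr ^+ 8.
Proof.
move=> c0; rewrite ler_wpM2l// lef_pV2 ?posrE ?n_ge ?ltr0n// exprn_gt0//.
by rewrite ltr0n root8_gt0.
Qed.

Lemma inv_pow_le k : (0 < k)%N -> (Nr ^+ k)^-1 <= Nr^-1.
Proof.
move=> k0; have N1 := Nr_ge1; rewrite lef_pV2 ?posrE ?exprn_gt0 ?ltr0n ?root8_gt0//.
by rewrite ler_eXnr.
Qed.

Lemma ninv_pow_le j : (j < 8)%N -> Nr ^+ j / n%:R <= Nr^-1.
Proof.
move=> j8; have N0 : 0 < Nr by rewrite ltr0n root8_gt0.
apply: le_trans (div_n _) _; first by rewrite exprn_ge0// ltW.
rewrite -[X in _ / _ ^+ X](subnKC (ltnW j8)) exprD invfM mulrA divff ?mul1r.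
  by apply: inv_pow_le; rewrite subn_gt0.
by rewrite expf_neq0// gt_eqF.
Qed.

(** From n + 1 <= (N + 1)^8 and ln(1 + N) <= N. *)
Lemma ln_n_le : ln n.+1%:R <= 8 * Nr.
Proof.
apply: (@le_trans _ _ (ln ((N.+1%:R : R) ^+ 8))).
  rewrite ler_ln ?posrE ?exprn_gt0 ?ltr0n// -natrX ler_nat; exact: root8_lt.
rewrite lnXn ?ltr0n// -[leLHS]mulr_natl ler_wpM2l//.
rewrite -natr1 addrC; apply: le_ln1Dx.
by rewrite (lt_le_trans (ltrN10 _)).
Qed.

Lemma ln_nlev_le : ln nlev%:R / n%:R <= d.+1%:R / Nr.
Proof.
have N0 : 0 < Nr by rewrite ltr0n root8_gt0.
apply: (@le_trans _ _ ((d.+1%:R * Nr ^+ 2) / n%:R)).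
  rewrite ler_pM2r ?invr_gt0 ?ltr0n//; apply: le_trans (ln_le_self _) _.
    by rewrite ltr0n addn_gt0 root8_gt0.
  rewrite /Nr -natrX -natrM ler_nat /nlev mulSn leq_add2r.
  by rewrite -{1}(expn1 (root8 n)) leq_pexp2l// root8_gt0.
by rewrite -mulrA ler_wpM2l// ninv_pow_le.
Qed.

Lemma expR_le_pad : expR (n%:R * step) <= pad.+1%:R.
Proof. by apply/ltW; exact: Num.Theory.truncnS_gt. Qed.

Lemma ln_pad_le : ln pad.+1%:R / n%:R <= 2 / Nr.
Proof.
have N0 : 0 < Nr by rewrite ltr0n root8_gt0.
have ns0 : 0 <= n%:R * step by rewrite mulr_ge0// ltW// step_gt0.
have e1 : 1 <= expR (n%:R * step).
  by apply: le_trans (expR_ge1Dx _); rewrite lerDl.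
have pe : pad.+1%:R <= 2 * expR (n%:R * step) :> R.
  rewrite -natr1 mulr_natl mulr2n lerD//.
  by rewrite Num.Theory.truncn_le ?expR_ge0.
have l2 : ln 2 <= 1 :> R.
  by have := @le_ln1Dx R 1; rewrite (_ : 1 + 1 = 2)//; apply.
apply: (@le_trans _ _ ((1 + n%:R * step) / n%:R)).
  rewrite ler_pM2r ?invr_gt0 ?ltr0n//.
  apply: (@le_trans _ _ (ln (2 * expR (n%:R * step)))).
    by rewrite ler_ln ?posrE ?mulr_gt0 ?expR_gt0// ltr0n.
  by rewrite lnM ?posrE ?expR_gt0// expRK lerD2r.
rewrite mulrDl mulrAC divff ?pnatr_eq0 -?lt0n// mul1r.
have h1 := @ninv_pow_le 0 isT; rewrite expr0 in h1.
have h2 : step <= Nr^-1 by exact: (@inv_pow_le 2).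
rewrite div1r in h1; lra.
Qed.

Lemma nstep_ge : Nr <= n%:R * step.
Proof.
have N0 : 0 < Nr by rewrite ltr0n root8_gt0.
rewrite /step -/Nr ler_pdivlMr ?exprn_gt0// -exprS; apply: le_trans n_ge.
by rewrite ler_weXn2l// Nr_ge1.
Qed.

(** Chebyshev's bound at deviation c n N^-2 equals (V / c^2) N^4 / n, and N^8 <= n. *)
Lemma cheb_le (V c : R) : 0 < c -> 0 <= V ->
  n%:R * V / (c * (n%:R * step)) ^+ 2 <= (V / c ^+ 2) / Nr.
Proof.
move=> c0 V0; have N0 : 0 < Nr by rewrite ltr0n root8_gt0.
have nn : n%:R != 0 :> R by rewrite pnatr_eq0 -lt0n.
have -> : n%:R * V / (c * (n%:R * step)) ^+ 2 = (V / c ^+ 2) * (Nr ^+ 4 / n%:R).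
  rewrite /step -/Nr; field; rewrite nn gt_eqF//= gt_eqF//.
by rewrite ler_wpM2l ?ninv_pow_le// divr_ge0// sqr_ge0.
Qed.

End Grid.

(** * Error and exponent of the universal code *)

Section Source.
Variables (p : 'M[C]_d -> R) (hp : source p).
Let a := eigenvalues (avgstate p).
Let ha : distr a := eigenvalues_distr (avgstate_density hp).

Definition univprob (n : nat) (r : R) : R :=
  @symprob R d n (root8 n) (d * root8 n ^ 2) (pad n) (step n) p r.

Lemma univcode_outprob_ge n r : outprob_ge p (univcode n) r = (univprob n r)%:E.
Proof. exact: symcode_outprob_ge. Qed.

(** Collects the rate overheads, in units of 1/[root8 n]: number of levels, padding, polynomial
    factor of the dimension, and the window width. *)
Definition kappa : R := d.+1%:R + 2 + 8 * (d * d + d)%:R + 1.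

Lemma srate_le n k : (0 < n)%N ->
  srate d n (root8 n) (d * root8 n ^ 2) (pad n) (step n) k <=
    lev (step n) k + (d.+1%:R + 2 + 8 * (d * d + d)%:R) / (root8 n)%:R.
Proof.
move=> n0; have nn : 0 < n%:R :> R by rewrite ltr0n.
have sd : (0 < symdim d n (step n) k)%N by apply: symdim_gt0 => //; exact: step_gt0.
have h1 := ln_nlev_le n0; have h2 := ln_pad_le n0.
have h3 : ln (symdim d n (step n) k)%:R / n%:R <=
    8 * (d * d + d)%:R / (root8 n)%:R + lev (step n) k.
  rewrite ler_pdivrMr//.
  apply: (@le_trans _ _ (ln (n.+1%:R ^+ (d * d + d) * expR (n%:R * lev (step n) k)))).
    rewrite ler_ln ?posrE ?mulr_gt0 ?exprn_gt0 ?expR_gt0 ?ltr0n//.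
    exact: rank_low.
  rewrite lnM ?posrE ?exprn_gt0 ?expR_gt0 ?ltr0n// expRK lnXn ?ltr0n//.
  rewrite [leRHS]mulrDl [lev _ _ * n%:R]mulrC lerD2r -[leLHS]mulr_natl.
  apply: le_trans (ler_wpM2l _ (ln_n_le n)) _; first exact: ler0n.
  have := @ninv_pow_le n n0 1 isT; rewrite expr1 ler_pdivrMr// => h.
  have q0 : 0 <= 8 * (d * d + d)%:R :> R by rewrite mulr_ge0.
  by have := ler_wpM2l q0 h; rewrite mulrA; apply: le_trans; rewrite mulrCA mulrA.
rewrite /srate natrM lnM ?posrE ?ltr0n ?addn_gt0 ?root8_gt0// mulrC.
rewrite -/(nlev n) 2!mulrDl.
move: h1 h2 h3; rewrite !(mulrDl _ _ _^-1); lra.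
Qed.

Lemma mstep n : (root8 n)%:R * step n = (root8 n)%:R^-1.
Proof. by rewrite /step expr2 invfM mulrA divff ?mul1r// pnatr_eq0 -lt0n root8_gt0. Qed.

Lemma univprob_upper n (r tau M : R) : (0 < n)%N -> kappa / (root8 n)%:R <= tau ->
  (forall b : 'I_d -> R, distr b -> r - tau <= entropy b -> (M%:E <= relentropy b a)%E) ->
  univprob n r <= (nlev n)%:R * (expR (- (n%:R * M)) * n.+1%:R ^+ d).
Proof.
move=> n0 hk hM.
apply: le_trans (symprob_upper (t := r - tau) (root8_gt0 n) hp _) _.
  (* The overhead of the rate over the level, together with the window width, is at most [kappa] /
     N, hence at most [tau]. *)
  move=> k rk; rewrite mstep; have := srate_le k n0.
  move: hk; rewrite /kappa (mulrDl _ 1) div1r; lra.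
rewrite ler_wpM2l// type_tail// => b hb /ltW; exact: hM.
Qed.

Lemma infovar_ge0 (b : 'I_d -> R) : distr b -> 0 <= infovar b.
Proof. by move=> [b0 _]; apply: sumr_ge0 => i _; rewrite mulr_ge0// sqr_ge0. Qed.

Lemma llrvar_ge0 (b : 'I_d -> R) : distr b -> 0 <= llrvar b a.
Proof. by move=> [b0 _]; apply: sumr_ge0 => i _; rewrite mulr_ge0// sqr_ge0. Qed.

(** The deviation in [symprob_lower] is half the padding exponent n [step]: as r <= H(b), the mass
    caught by low rates is at most e^(-n step / 2), and the halving gives the factors 4 on the
    variances. *)
Lemma univprob_lower n (b : 'I_d -> R) (r : R) : (0 < n)%N -> distr b ->
  (forall i, b i != 0 -> a i != 0) -> r <= entropy b ->
  expR (- (n%:R * realent b a) - 2^-1 * (n%:R * step n)) *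
    (1 - (4 * infovar b + 4 * llrvar b a + 2) / (root8 n)%:R) <= univprob n r.
Proof.
move=> n0 hb ba rb; have nn : 0 < n%:R :> R by rewrite ltr0n.
have N0 : 0 < (root8 n)%:R :> R by rewrite ltr0n root8_gt0.
have hns := nstep_ge n0; have ns0 := lt_le_trans N0 hns.
have s0 : 0 < 2^-1 * (n%:R * step n) by rewrite mulr_gt0.
apply: le_trans (symprob_lower (pad n) d0 (root8_gt0 n) (step_gt0 n) (step_cover n)
  hp r n0 hb ba s0).
rewrite ler_wpM2l ?expR_ge0//.
have c0 : 0 < 2^-1 :> R by rewrite invr_gt0.
have h1 := cheb_le n0 c0 (infovar_ge0 hb).
have h2 := cheb_le n0 c0 (llrvar_ge0 hb).
have h3 : expR (2^-1 * (n%:R * step n) - n%:R * entropy b) *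
    (expR (n%:R * r) / (pad n).+1%:R) <= 2 / (root8 n)%:R.
  apply: (@le_trans _ _ (expR (- (2^-1 * (n%:R * step n))))).
    rewrite mulrA ler_pdivrMr ?ltr0n// -expRD.
    apply: (@le_trans _ _ (expR (- (2^-1 * (n%:R * step n))) * expR (n%:R * step n))).
      rewrite -expRD ler_expR.
      have := ler_wpM2l (ltW nn) rb; lra.
    by rewrite ler_wpM2l ?expR_ge0// expR_le_pad.
  apply: le_trans (expRN_le_inv s0) _.
  rewrite invfM invrK ler_wpM2l// lef_pV2 ?posrE//.
rewrite exprVn invrK in h1 h2.
have e4 : 2 ^+ 2 = 4 :> R by rewrite expr2 -natrM.
rewrite e4 in h1 h2.
have -> : (4 * infovar b + 4 * llrvar b a + 2) / (root8 n)%:R =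
  infovar b * 4 / (root8 n)%:R + llrvar b a * 4 / (root8 n)%:R + 2 / (root8 n)%:R.
  by field; rewrite gt_eqF.
rewrite -/a; move: h1 h2 h3.
move: (n%:R * infovar b / _) (n%:R * llrvar b a / _) (expR _ * _) => A B E.
move: (infovar b * 4 / _) (llrvar b a * 4 / _) (2 / _) => A' B' E'; lra.
Qed.

Lemma worderror_ge0 n (x : {ffun 'I_n -> 'M[C]_d}) : words x ->
  0 <= worderror (univcode n) x.
Proof.
move=> hx; apply: sumr_ge0 => w _ /=.
apply: mulr_ge0; last exact: sqr_ge0.
rewrite tr_encoder_projcode; last by move=> v; apply: symE_onb; exact: step_gt0.
rewrite Re_realM mulr_ge0 ?symc_ge0//.
exact: (rtr_ge0 (tensor_psd hx) (proj_psd (symE_proj _ _ _ (step_gt0 n) _))).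
Qed.

Lemma avgerror_ge0 n : (0 <= avgerror p (univcode n))%E.
Proof.
apply: esum_ge0 => x hx; rewrite lee_fin mulr_ge0//; last exact: worderror_ge0.
exact: (wordprob_ge0 hp hx).
Qed.

Lemma card_interval Z k0 g : (k0 + g <= Z)%N ->
  #|[pred k : 'I_Z | k0 <= k < k0 + g]%N| = g.
Proof.
move=> h; rewrite -sum1_card.
rewrite -(big_mkord (fun k => k0 <= k < k0 + g)%N (fun=> 1%N)).
transitivity (\sum_(k0 <= k < k0 + g) 1)%N.
  rewrite (big_nat_widen _ _ _ _ _ h) [RHS](big_nat_widenl _ 0)//.
  by apply: eq_bigl => k; rewrite andbC.
by rewrite sum_nat_const_nat muln1 addnC addnK.
Qed.

Lemma rtr_symE n m (eta : R) k (T : 'M[C]_(tdim d n)) : \tr T = 1 ->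
  1 - rtr T (symE d n m eta k) =
  rtr T (1%:M - Qt d n (lev eta k)) + rtr T (Qt d n (lev eta k - m%:R * eta)).
Proof.
move=> T1; set A := Qt d n (lev eta k); set B := Qt d n (lev eta k - m%:R * eta).
have e1 : rtr T (1%:M - A) = 1 - rtr T A.
  exact: etrans (rtrB T 1%:M A) (congr1 (fun z => z - rtr T A) (rtr1 T1)).
have e2 : rtr T (symE d n m eta k) = rtr T A - rtr T B := rtrB T A B.
have e3 (x y z u v : R) : x = 1 - y -> u = y - z -> v = z -> 1 - u = x + v.
  by move=> -> -> ->; rewrite opprB addrA addrAC.
exact: e3 e1 e2 erefl.
Qed.

(** What lies above the window is bounded by the concentration of type entropies, what lies below by
    [typical_low]. *)
Lemma symE_typical n k : (0 < n)%N -> 8 * (d * d + d)%:R <= (root8 n)%:R :> R ->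
  entropy a + step n <= lev (step n) k ->
  lev (step n) k - (root8 n)%:R * step n <= entropy a - 3 * step n ->
  1 - rtr (tpow (fun _ : 'I_n => avgstate p)) (symE d n (root8 n) (step n) k)
    <= (2 * infovar a + 1) / (root8 n)%:R.
Proof.
move=> n0 hq hup hlo; have nn : 0 < n%:R :> R by rewrite ltr0n.
have N0 : 0 < (root8 n)%:R :> R by rewrite ltr0n root8_gt0.
have hns := nstep_ge n0; have ns0 := lt_le_trans N0 hns.
have hrho := avgstate_density hp.
pose T := tpow (fun _ : 'I_n => avgstate p); rewrite -/T.
pose u := lev (step n) k; pose l := u - (root8 n)%:R * step n.
have T1 : \tr T = 1 by exact: T_tr.
rewrite (rtr_symE _ _ _ T1) -/u -/l.
have cV := cheb_le n0 ltr01 (infovar_ge0 ha).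
rewrite mul1r expr1n divr1 in cV.
have h1 : rtr T (1%:M - Qt d n u) <= infovar a / (root8 n)%:R.
  apply: le_trans (tail_upper n hrho u) _.
  apply: le_trans cV; apply: le_trans (tentropy_concentration n0 ha ns0).
  rewrite big_mkcond [leRHS]big_mkcond/=; apply: ler_sum => x _.
  case: ifPn => [hx|_]; last by case: ifP => // _; apply: pword_ge0; case: ha.
  rewrite ifT// -mulrDr ltr_pM2l//; exact: le_lt_trans hup hx.
have h2 : rtr T (Qt d n l) <= infovar a / (root8 n)%:R + 1 / (root8 n)%:R.
  apply: le_trans (typical_low hrho l n0 ns0) _.
  rewrite lerD//.
  rewrite -[n.+1%:R]lnK ?posrE ?ltr0n// -expRM_natr -!expRD.
  apply: (@le_trans _ _ (expR (- (n%:R * step n)))).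
    (* Of the three steps of margin, one pays for the deviation and one for the polynomial factor;
       the third remains as e^(-n step). *)
    rewrite ler_expR.
    have hl := ler_wpM2l (ltW nn) hlo; rewrite -/u -/l in hl.
    have hn := ln_n_le n.
    have hln0 : 0 <= ln n.+1%:R :> R by rewrite ln_ge0// ler1n.
    have hqn : ln n.+1%:R * (d * d + d)%:R <= n%:R * step n.
      apply: (@le_trans _ _ (8 * (root8 n)%:R * (d * d + d)%:R)).
        by rewrite ler_wpM2r.
      rewrite mulrAC; apply: (@le_trans _ _ ((root8 n)%:R * (root8 n)%:R)).
        by rewrite ler_wpM2r// ltW.
      rewrite -expr2 /step ler_pdivlMr ?exprn_gt0// -exprD.
      by apply: le_trans (n_ge n0); rewrite ler_weXn2l ?Nr_ge1.
    rewrite -mulr_natr in hqn *; rewrite -/a; lra.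
  by rewrite div1r; apply: le_trans (expRN_le_inv ns0) _; rewrite lef_pV2 ?posrE.
have -> : (2 * infovar a + 1) / (root8 n)%:R =
  infovar a / (root8 n)%:R + (infovar a / (root8 n)%:R + 1 / (root8 n)%:R).
  by field; rewrite gt_eqF.
exact: lerD.
Qed.

(** There are N - 5 good levels out of a weight of N, each losing at most (2V + 1) / N by
    [symE_typical], where V is the varentropy. The constant 7 is 2 plus the 5 lost levels. *)
Lemma avgerror_upper n : (0 < n)%N -> (5 <= root8 n)%N ->
  8 * (d * d + d)%:R <= (root8 n)%:R :> R ->
  (avgerror p (univcode n) <= ((4 * infovar a + 7) / (root8 n)%:R)%:E)%E.
Proof.
move=> n0 N5 hq.
have N0 : 0 < (root8 n)%:R :> R by rewrite ltr0n root8_gt0.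
have st0 := step_gt0 n.
have H0 := entropy_ge0 ha; have Hd := entropy_le_ln ha.
pose h := entropy a / step n.
have h0 : 0 <= h by rewrite divr_ge0// ltW.
have hE : h * step n = entropy a by rewrite divfK// gt_eqF.
(* The first level at least one step above the entropy for certain. The last good level is k0 + N -
   6, whose lower edge k0 - 6 is still three steps below it, since k0 <= h + 2. *)
pose k0 := (Num.truncn h).+2.
have k0lo : h + 1 <= k0%:R.
  rewrite -[k0%:R]natr1 lerD2r ltW//; exact: Num.Theory.truncnS_gt.
have k0up : k0%:R <= h + 2.
  rewrite /k0 -addn2 natrD lerD2r; by rewrite Num.Theory.truncn_le.
have hZ : (k0 + (root8 n - 5) <= root8 n + d * root8 n ^ 2)%N.
  have : (Num.truncn h <= d * root8 n ^ 2)%N.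
    rewrite -(ler_nat R); apply: (@le_trans _ _ h); first by rewrite Num.Theory.truncn_le.
    by rewrite ler_pdivrMr//; apply: le_trans Hd (step_cover n).
  rewrite /k0; lia.
pose G := [pred k : 'I_(root8 n + d * root8 n ^ 2) | k0 <= k < k0 + (root8 n - 5)]%N.
have cG : #|G| = (root8 n - 5)%N by exact: card_interval.
have cG' : (#|G| <= root8 n)%N by rewrite cG leq_subr.
apply: le_trans (symcode_avgerror (pad n) d0 (root8_gt0 n) st0 (step_cover n) hp cG' _) _.
  move=> k /andP[kl ku]; apply: symE_typical => //.
    rewrite -hE /lev -[X in _ + X]mul1r -mulrDl ler_wpM2r// ?(ltW st0)//.
    by apply: le_trans k0lo _; rewrite ler_nat.
  rewrite -hE /lev -!mulrBl ler_wpM2r ?(ltW st0)//.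
  have : (k + 6 <= k0 + root8 n)%N by lia.
  rewrite -(ler_nat R) !natrD; lra.
rewrite lee_fin cG natrB//.
set V := infovar a; set N := (root8 n)%:R in N0 *.
have V0 : 0 <= V := infovar_ge0 ha.
rewrite mulrC ler_pM2r ?invr_gt0//.
rewrite -[_ *+ (root8 n - 5)]mulr_natr natrB// -/N.
have : (2 * ((2 * V + 1) / N)) * (N - 5) <= (2 * ((2 * V + 1) / N)) * N.
  rewrite ler_wpM2l ?gerBl// mulr_ge0// divr_ge0 ?(ltW N0)//; lra.
have -> : 2 * ((2 * V + 1) / N) * N = 4 * V + 2 by field; rewrite gt_eqF.
lra.
Qed.

Lemma exponent_ge n (P B M : R) : (0 < n)%N -> 0 < B -> P <= B -> M <= - ln B / n%:R ->
  (M%:E <= (- n%:R^-1)%:E * lne P%:E)%E.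
Proof.
move=> n0 B0 PB hM; have nn : 0 < n%:R :> R by rewrite ltr0n.
(* At probability 0 the logarithm is -oo and the exponent +oo. *)
have [P0|P0] := leP P 0.
  rewrite /= P0 lt0_muleNy ?leey// lte_fin oppr_lt0 invr_gt0//.
rewrite lne_EFin// -EFinM lee_fin; apply: le_trans hM _.
rewrite mulNr mulrC -mulNr ler_nM2l ?oppr_lt0 ?invr_gt0//.
by rewrite ler_ln ?posrE.
Qed.

Lemma exponent_le n (P B M : R) : (0 < n)%N -> 0 < B -> B <= P -> - ln B / n%:R <= M ->
  ((- n%:R^-1)%:E * lne P%:E <= M%:E)%E.
Proof.
move=> n0 B0 PB hM; have nn : 0 < n%:R :> R by rewrite ltr0n.
have P0 : 0 < P by exact: lt_le_trans PB.
rewrite lne_EFin// -EFinM lee_fin; apply: le_trans hM.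
rewrite [leRHS]mulNr [X in _ <= - X]mulrC -mulNr ler_nM2l ?oppr_lt0 ?invr_gt0//.
by rewrite ler_ln ?posrE.
Qed.

Lemma avgerror_cvg : (fun n => avgerror p (univcode n)) @ \oo --> 0%E.
Proof.
apply: cvge_by_bounds => M hM.
  by apply: nearW => n; apply: le_trans (ltW hM) (avgerror_ge0 n).
rewrite lte_fin in hM.
have h1 := near_root8 (4 * infovar a + 7) hM.
have h2 := @near_root8 R 5 1 ltr01.
have h3 := @near_root8 R (8 * (d * d + d)%:R) 1 ltr01.
near=> n.
have [n0 k1] : (0 < n)%N /\ (4 * infovar a + 7) / (root8 n)%:R <= M by near: n.
have [_ k2] : (0 < n)%N /\ 5 / (root8 n)%:R <= 1 :> R by near: n.
have [_ k3] : (0 < n)%N /\ 8 * (d * d + d)%:R / (root8 n)%:R <= 1 :> R by near: n.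
have N0 : 0 < (root8 n)%:R :> R by rewrite ltr0n root8_gt0.
rewrite ler_pdivrMr// mul1r ler_nat in k2; rewrite ler_pdivrMr// mul1r in k3.
by apply: le_trans (avgerror_upper n0 k2 k3) _; rewrite lee_fin.
Unshelve. all: by end_near. Qed.

(** An infimum over the empty set is +oo; then only the lower estimate has content. *)
Lemma exponent_cvg (r : R) :
  (fun n : nat => ((- n%:R^-1)%:E * lne (outprob_ge p (univcode n) r))%E) @ \oo -->
  ereal_inf [set relentropy b a
            | b in [set b : 'I_d -> R | distr b /\ r <= entropy b]].
Proof.
have [a0 a1] := ha.
apply: cvge_by_bounds => M.
  (* The gap from M to [M'] absorbs the polynomial factors, while [tau] from [rate_lsc] absorbs the
     rate overhead. *)
  move=> /lte_real_dense[M' MM' hM'].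
  have [tau tau0 htau] := rate_lsc a0 hM'.
  have dM : 0 < M' - M by rewrite subr_gt0.
  have h1 := near_root8 kappa tau0.
  have h2 := near_root8 (d.+1%:R + 8 * d%:R) dM.
  near=> n.
  have [n0 k1] : (0 < n)%N /\ kappa / (root8 n)%:R <= tau by near: n.
  have [_ k2] : (0 < n)%N /\ (d.+1%:R + 8 * d%:R) / (root8 n)%:R <= M' - M by near: n.
  have nn : 0 < n%:R :> R by rewrite ltr0n.
  have N0 : 0 < (root8 n)%:R :> R by rewrite ltr0n root8_gt0.
  have L0 : 0 < (nlev n)%:R :> R by rewrite ltr0n addn_gt0 root8_gt0.
  rewrite univcode_outprob_ge.
  apply: exponent_ge (univprob_upper n0 k1 htau) _ => //.
    by rewrite !mulr_gt0 ?expR_gt0// exprn_gt0.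
  rewrite !lnM ?posrE ?mulr_gt0 ?expR_gt0 ?exprn_gt0// expRK lnXn// ler_pdivlMr//.
  have h3 := ln_nlev_le n0; rewrite ler_pdivrMr// in h3.
  have h4 : ln n.+1%:R *+ d <= 8 * d%:R / (root8 n)%:R * n%:R :> R.
    rewrite -[leLHS]mulr_natl; apply: le_trans (ler_wpM2l _ (ln_n_le n)) _; first exact: ler0n.
    have := @ninv_pow_le n n0 1 isT; rewrite expr1 ler_pdivrMr// => h.
    have q0 : 0 <= 8 * d%:R :> R by rewrite mulr_ge0.
    by have := ler_wpM2l q0 h; rewrite mulrA; apply: le_trans; rewrite mulrCA mulrA.
  have h5 := ler_wpM2r (ltW nn) k2; rewrite !mulrDl in h5.
  move: h3 h4 h5; rewrite mulrC; lra.
(* A nearly optimal b; its divergence is finite, so its support lies in that of a and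
   [univprob_lower] applies. *)
move=> /ereal_inf_lt[_ [b [hb rb] <-] hbM].
have [ba _] := (relentropy_le_real M a0 hb).1 (ltW hbM).
have {}ba i : b i != 0 -> a i != 0 by apply: contra_neq; exact: ba.
have DM : realent b a < M.
  rewrite -lte_fin; apply: le_lt_trans hbM; rewrite /realent /relentropy -sumEFin.
  apply: lee_sum => i _; case: eqP => [->|/eqP bi]; first by rewrite mul0r.
  by rewrite (negPf (ba i bi)).
have dM : 0 < M - realent b a by rewrite subr_gt0.
have hf : 0 < 2^-1 :> R by rewrite invr_gt0.
have h1 := near_root8 (4 * infovar b + 4 * llrvar b a + 2) hf.
have h2 := near_root8 2 dM.
near=> n.
have [n0 k1] : (0 < n)%N /\ (4 * infovar b + 4 * llrvar b a + 2) / (root8 n)%:R <= 2^-1 by near: n.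
have [_ k2] : (0 < n)%N /\ 2 / (root8 n)%:R <= M - realent b a by near: n.
have nn : 0 < n%:R :> R by rewrite ltr0n.
have N0 : 0 < (root8 n)%:R :> R by rewrite ltr0n root8_gt0.
rewrite univcode_outprob_ge.
(* For large n the bracket in [univprob_lower] is at least 1/2. *)
pose B := expR (- (n%:R * realent b a) - 2^-1 * (n%:R * step n)) * 2^-1.
have B0 : 0 < B by rewrite mulr_gt0// expR_gt0.
apply: (exponent_le n0 B0).
  apply: le_trans (univprob_lower n0 hb ba rb).
  by rewrite ler_wpM2l ?expR_ge0//; lra.
rewrite /B lnM ?posrE ?expR_gt0// expRK lnV ?posrE// ler_pdivrMr//.
have l2 : ln 2 <= 1 :> R by have := @le_ln1Dx R 1; rewrite (_ : 1 + 1 = 2)//; apply.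
have h3 := @ninv_pow_le n n0 0 isT; rewrite expr0 ler_pdivrMr// in h3.
have h4 : step n <= (root8 n)%:R^-1 := @inv_pow_le n 2 isT.
have h5 := ler_wpM2l (ltW nn) h4; rewrite mulrC [_ * _^-1]mulrC in h5.
have h6 := ler_wpM2r (ltW nn) k2.
have h7 : 0 <= n%:R * step n by rewrite mulr_ge0// ltW// step_gt0.
rewrite -mulrA mulrBl in h6.
move: h3 h5 h6 h7; lra.
Unshelve. all: by end_near. Qed.

End Source.
End Asymptotics.

(** * Dimension zero *)

Section TrivialCode.
Variables (R : realType) (K : nat).
Local Notation C := R[i].

Lemma psd1 : psdmx (1%:M : 'M[C]_K).
Proof. by have := @psd_gram C K K 1%:M; rewrite adj1 mulmx1. Qed.

Lemma unit_sum1 : \sum_(w : unit) (1%:M : 'M[C]_K) = 1%:M.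
Proof. by rewrite (bigD1 tt)//= big1 ?addr0// => -[]. Qed.

Lemma id_kraus_sum :
  \sum_(w : unit) (1%:M : 'M[C]_K)^t* *m (1%:M : 'M[C]_K) = 1%:M.
Proof. by rewrite adj1 mulmx1 unit_sum1. Qed.

Definition trivcode : vlcode R K :=
  @Vlcode R K unit (fun=> 1%:M) (fun=> psd1) unit_sum1 (fun=> K)
    (fun=> kraus (fun _ : unit => 1%:M)) (fun=> kraus_tpcp id_kraus_sum)
    (fun=> kraus (fun _ : unit => 1%:M)) (fun=> kraus_tpcp id_kraus_sum).

End TrivialCode.

(** An empty matrix has trace 0, so in dimension 0 there is no density operator to carry the mass.
    Any code then satisfies the theorem vacuously. *)
Lemma source_dim_gt0 (R : realType) (d : nat) (p : 'M[R[i]]_d -> R) :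
  source p -> (0 < d)%N.
Proof.
move=> [_ p1]; rewrite lt0n; apply/eqP => d0.
have e : (\esum_(rho in @density R d) (p rho)%:E = 0)%E.
  apply: esum1 => rho [_ trho]; exfalso; move: trho; rewrite /mxtrace big1 => [|i _].
    by move/esym/eqP; rewrite oner_eq0.
  by exfalso; have := leq_ltn_trans (leq0n i) (ltn_ord i); rewrite d0.
by move: p1; rewrite e => /eqP; rewrite eqe eq_sym oner_eq0.
Qed.

Theorem theorem1 (R : realType) (d : nat) :
  exists c : forall n : nat, vlcode R (tdim d n),
    universal c /\
    forall (p : 'M[R[i]]_d -> R) (r : R), source p ->
      (fun n : nat => ((- n%:R^-1)%:E * lne (outprob_ge p (c n) r))%E) @ \oo -->
      ereal_inf [set relentropy b (eigenvalues (avgstate p))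
                | b in [set b : 'I_d -> R | distr b /\ r <= entropy b]].
Proof.
have [d0|d0] := posnP d.
  exists (fun n => trivcode R (tdim d n)).
  by split=> [p|p r] /source_dim_gt0 h; exfalso; move: h; rewrite d0.
exists (@univcode R d d0); split=> [p hp|p r hp]; first exact: avgerror_cvg.
exact: exponent_cvg.
Qed.
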